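(* For every integer $N\ge 1$ and every $\beta$ with $0\le\beta\leq 1$, $$\operatorname{Var}(F_N(\beta))\leq N\int_0^\beta s\,\mathbb E\langle R_{\sigma\rho}^2\rangle_s\,ds-\frac{\beta^2}{2},$$ where $F_N(\beta)$ is the free energy of the Sherrington--Kirkpatrick model on $N$ spins (zero external field) and $R_{\sigma\rho}$ is the overlap of two independent samples $\sigma,\rho$ from the Gibbs measure at inverse temperature $s$ with the same disorder.
   Context: For an integer $N\ge 1$, let $(g_{ij})_{1\le i<j\le N}$ be independent centered real Gaussian random variables of variance $1/N$ (the disorder); expectation $\mathbb E$ and variance $\operatorname{Var}$ are with respect to these variables. For $\sigma\in\{-1,1\}^N$ define $H_N(\sigma)=\sum_{1\le i<j\le N} g_{ij}\sigma_i\sigma_j$. For $\beta\ge 0$, $$Z_N(\beta)=\frac1{2^N}\sum_{\sigma\in\{-1,1\}^N}e^{\beta H_N(\sigma)},\qquad F_N(\beta)=\log Z_N(\beta).$$ The Gibbs measure at inverse temperature $\beta$ is the (random) probability measure on $\{-1,1\}^N$ with weights $\frac{1}{2^N Z_N(\beta)}e^{\beta H_N(\sigma)}$. For functions of two configurations $(\sigma,\rho)$, $\langle\cdot\rangle_\beta$ denotes the average when $\sigma$ and $\rho$ are two independent samples from this Gibbs measure (same disorder), i.e. $$\langle f\rangle_\beta=\frac{1}{4^N Z_N(\beta)^2}\sum_{\sigma,\rho\in\{-1,1\}^N}f(\sigma,\rho)\,e^{\beta H_N(\sigma)+\beta H_N(\rho)}.$$ The overlap is $R_{\sigma\rho}=\frac1N\sum_{i=1}^N\sigma_i\rho_i$.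 *)

(* Defs.v *)
From HB Require Import structures.
From mathcomp Require Import all_boot all_order all_algebra.
From mathcomp Require Import all_classical all_reals all_analysis.

Set Implicit Arguments.
Unset Strict Implicit.
Unset Printing Implicit Defensive.

Import Order.TTheory GRing.Theory Num.Theory.
Import numFieldNormedType.Exports.

Local Open Scope classical_set_scope.
Local Open Scope ring_scope.

(* The configuration space {-1,1}^N is encoded as {ffun 'I_N -> bool}: the
   boolean [s i] stands for the spin (-1)^(s i), so [false] is +1 and [true]
   is -1. *)
Definition config (N : nat) := {ffun 'I_N -> bool}.

Definition spin (R : realType) (N : nat) (s : config N) (i : 'I_N) : R :=
  (-1) ^+ s i.

(* Below, [x : 'I_N -> 'I_N -> R] is a realization of the disorder; only the
   entries [x i j] with [i < j] matter. *)

Definition hamiltonian (R : realType) (N : nat) (x : 'I_N -> 'I_N -> R)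
    (s : config N) : R :=
  \sum_(i < N) \sum_(j < N | (i < j)%N) x i j * spin R s i * spin R s j.

Definition partition_function (R : realType) (N : nat) (beta : R)
    (x : 'I_N -> 'I_N -> R) : R :=
  (2 ^+ N)^-1 * \sum_(s : config N) expR (beta * hamiltonian x s).

Definition free_energy (R : realType) (N : nat) (beta : R)
    (x : 'I_N -> 'I_N -> R) : R :=
  ln (partition_function beta x).

(* Average of [f] over two replicas, sampled independently from the Gibbs
   measure with the same disorder. *)
Definition gibbs_average (R : realType) (N : nat) (beta : R)
    (x : 'I_N -> 'I_N -> R) (f : config N -> config N -> R) : R :=
  (4 ^+ N * partition_function beta x ^+ 2)^-1 *
  \sum_(s : config N) \sum_(r : config N)
    f s r * expR (beta * hamiltonian x s + beta * hamiltonian x r).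

Definition overlap (R : realType) (N : nat) (s r : config N) : R :=
  N%:R^-1 * \sum_(i < N) spin R s i * spin R r i.

(* Mutual independence of the finite family of real random variables [X i],
   [i \in A]: the product rule for every subfamily. *)
Definition mutually_independent (R : realType) (d : measure_display)
    (T : measurableType d) (P : probability T R) (I : finType) (A : {set I})
    (X : I -> T -> R) : Prop :=
  forall (J : {set I}) (B : I -> set R),
    J \subset A -> (forall i, measurable (B i)) ->
    P (\bigcap_(i in [set i | i \in J]) (X i @^-1` B i)) =
    (\prod_(i in J) P (X i @^-1` B i))%E.

(* The [g i j], [i < j], are independent centered Gaussians of variance 1/N.
   The second parameter of [normal_prob] is the standard deviation. Laws are
   compared on measurable sets only, a measure being a function on all sets. *)
Definition gaussian_disorder (R : realType) (d : measure_display)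
    (T : measurableType d) (P : probability T R) (N : nat)
    (g : 'I_N -> 'I_N -> {RV P >-> R}) : Prop :=
  (forall (i j : 'I_N), (i < j)%N -> forall B : set R, measurable B ->
     distribution P (g i j) B = normal_prob 0 (Num.sqrt N%:R^-1) B) /\
  mutually_independent P (finset (fun p : 'I_N * 'I_N => (p.1 < p.2)%N))
    (fun p => g p.1 p.2).

(* Main.v *)
Require Import Defs.
From mathcomp Require Import all_boot all_order all_algebra.
From mathcomp Require Import all_classical all_reals all_analysis.
From mathcomp Require Import measurable_realfun ring lra.
Import Order.TTheory GRing.Theory Num.Theory.
Import numFieldNormedType.Exports.
Local Open Scope classical_set_scope.
Local Open Scope ring_scope.

(** The weights of the partition function sum to one, so [Z = partition_function
beta] has expectation [expR (beta ^+ 2 * (N - 1) / 4)] : the Hamiltonian at each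
configuration is a centered Gaussian of variance [(N - 1) / 2]. Write [F = ln Z].
The bound is the combination of an identity and of an inequality.

The identity says that the right-hand side equals [2 * (ln E[Z] - E[F])].
Gaussian integration by parts ([gaussian_ibp]) turns the mean energy at inverse
temperature [t] into [t * N / 2 * (1 - E<R^2>)], and the mean energy is the
derivative of [E[F]] in [t] ([integral_mean_energy]).

The inequality is [Var F <= 2 * (ln E[expR F] - E[F])], true of a convex function
[F] of a Gaussian vector ([variance_lnZ_le]). In one dimension, with Gaussian
density [gam] of variance [v], substitute [x + V x] for the variable in
[\int expR (F z) * gam z], bound [F (x + V x)] from below by
[F x + F' x * V x], which is convexity, and apply Jensen's inequality. The best
[V] is the solution of Stein's equation [V' x - x * V x / v = - (F x - E[F])]
([stein_solution]). Convexity makes [V'] nonnegative, and then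
[ln (1 + V') >= V' - V' ^+ 2 / 2] ([expR_le1D]). One integration by parts shows
that the resulting lower bound for [ln E[expR F]] is exactly [E[F] + Var F / 2]
([gauss_variance_le]).

Several coordinates are treated one after the other ([vec_variance_le]).
For the induction to go through, convexity is stated as a comparison between two
points: [m y + C y + <D y, y' - y>] bounds [ln Z y'] from below for all [y]
and [y']. Freezing the first coordinate of [y] at [x] and that of [y'] at [z]
gives an instance of the same comparison in one dimension less, and the function
[C] stores the variance already gained from the other coordinates. On the side of
[Z] nothing has to be estimated, because freezing or integrating a coordinate only
multiplies the weights of the configurations by explicit factors.

The couplings, listed as a sequence, have the iterated product of one-dimensional
Gaussian laws as their joint law ([tovec_law]), where all the computations take
place. *)

Set Implicit Arguments.
Unset Strict Implicit.
Unset Printing Implicit Defensive.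

(** * Calculus on the whole line *)
Section whole_line.
Context {R : realType}.
Local Notation mu := (@lebesgue_measure R).
Implicit Types f g F G : R -> R.

Lemma cvg_Rintegral_sym f : mu.-integrable setT (EFin \o f) ->
  (\int[mu]_(x in `[- n%:R, n%:R]) f x)%R @[n --> \oo] --> (\int[mu]_x f x)%R.
Proof.
move=> intf; have mf := measurable_int _ intf.
pose f_ (n : nat) : R -> \bar R := (EFin \o f) \_ `[- n%:R, n%:R].
have [] := @dominated_convergence _ _ _ mu setT measurableT f_ (EFin \o f)
    (abse \o (EFin \o f)).
- move=> n; apply: (measurable_int mu).
  apply: (integrable_mkcond _ _).1; first exact: measurable_itv.
  exact: integrableS intf.
- exact: mf.
- apply: aeW => x _; apply: cvg_near_cst.
  near=> n; rewrite /f_ patchE mem_set//= in_itv/= -ler_norml.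
  by near: n; exact: nbhs_infty_ger.
- exact: integrable_abse.
- apply: aeW => x n _; rewrite /f_ patchE /=; case: ifPn => // _.
  by rewrite abse0.
move=> _ _; rewrite -[(\int[mu]_x _)%E]fineK; last exact: integrable_fin_num.
move=> /fine_cvg; under eq_fun do rewrite /= -integral_mkcond.
by [].
Unshelve. all: by end_near. Qed.

Lemma cvg_Rintegral_Ny f : mu.-integrable setT (EFin \o f) ->
  (\int[mu]_(x in `]-oo, - n%:R]) f x)%R @[n --> \oo] --> (0 : R).
Proof.
move=> intf; have mf := measurable_int _ intf.
pose f_ (n : nat) : R -> \bar R := (EFin \o f) \_ `]-oo, - n%:R].
have [] := @dominated_convergence _ _ _ mu setT measurableT f_ (cst 0%E)
    (abse \o (EFin \o f)).
- move=> n; apply: (measurable_int mu).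
  apply: (integrable_mkcond _ _).1; first exact: measurable_itv.
  exact: integrableS intf.
- exact: measurable_cst.
- apply: aeW => x _; apply: cvg_near_cst.
  near=> n; rewrite /f_ patchE; case: ifPn => //.
  rewrite inE/= in_itv/= => xn; exfalso; move: xn; apply/negP; rewrite -ltNge ltrNl.
  by near: n; exact: nbhs_infty_gtr.
- exact: integrable_abse.
- apply: aeW => x n _; rewrite /f_ patchE /=; case: ifPn => // _.
  by rewrite abse0.
move=> _ _; rewrite integral0.
move=> /fine_cvg; under eq_fun do rewrite /= -integral_mkcond.
by [].
Unshelve. all: by end_near. Qed.

Lemma is_derive_cont F f : (forall x : R, is_derive x 1 F (f x)) -> continuous F.
Proof.
by move=> dF x; apply: differentiable_continuous; apply/derivable1_diffP.
Qed.

Lemma is_derive_LR F f a b : (forall x : R, is_derive x 1 F (f x)) ->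
  derivable_oo_LRcontinuous F a b.
Proof.
move=> dF; have cF := is_derive_cont dF.
split; first by move=> x _; have := dF x => ?.
- by apply: cvg_at_right_filter; exact: cF.
- by apply: cvg_at_left_filter; exact: cF.
Qed.

Lemma is_derive1E F f : (forall x : R, is_derive x 1 F (f x)) -> derive1 F = f.
Proof. by move=> dF; apply/funext => x; rewrite derive1E; exact: derive_val. Qed.

Lemma is_derive_FTC F f a b : (forall x : R, is_derive x 1 F (f x)) ->
  continuous f -> a <= b ->
  (\int[mu]_(x in `[a, b]) f x = F b - F a)%R.
Proof.
move=> dF cf; rewrite le_eqVlt => /predU1P[<-|ab].
  by rewrite set_itv1 Rintegral_set1 subrr.
rewrite /Rintegral (@continuous_FTC2 _ f F a b)//.
- exact: continuous_subspaceT.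
- exact: is_derive_LR dF.
- by move=> x _; rewrite (is_derive1E dF).
Qed.

Lemma is_derive_le F f a b : a <= b ->
  (forall x : R, a <= x <= b -> is_derive x 1 F (f x)) ->
  (forall x, a <= x <= b -> 0 <= f x) -> F a <= F b.
Proof.
move=> ab dF f0; have [||c] := @MVT_segment _ F f _ _ ab.
- by move=> x; rewrite in_itv/= => /andP[? ?]; apply: dF; rewrite !ltW.
- apply: derivable_within_continuous => x; rewrite in_itv/= => xab.
  by have := dF _ xab => ?.
rewrite in_itv/= => cab; rewrite -subr_ge0 => ->.
by rewrite mulr_ge0 ?f0// subr_ge0.
Qed.

(** [F] decreases to its limit [0]. *)
Lemma is_derive_ge0_cvgy F f a : (forall x : R, a <= x -> is_derive x 1 F (f x)) ->
  (forall x, a <= x -> f x <= 0) -> F n.+1%:R @[n --> \oo] --> 0 ->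
  forall x, a <= x -> 0 <= F x.
Proof.
move=> dF f0 cF x ax; apply: (cvgr_to_le cF); near=> n.
have xn : x <= n.+1%:R.
  apply: (@le_trans _ _ n%:R); last by rewrite ler_nat.
  by near: n; exact: nbhs_infty_ger.
rewrite -lerN2; apply: (@is_derive_le (fun x => - F x) (fun x => - f x)) => // y /andP[xy _].
- by apply: is_deriveN; apply: dF; exact: le_trans xy.
- by rewrite oppr_ge0 f0// (le_trans ax).
Unshelve. all: by end_near. Qed.

Lemma is_derive_le0_cvgNy F f a : (forall x : R, x <= a -> is_derive x 1 F (f x)) ->
  (forall x, x <= a -> f x <= 0) -> F (- n.+1%:R) @[n --> \oo] --> 0 ->
  forall x, x <= a -> F x <= 0.
Proof.
move=> dF f0 cF x ax; apply: (cvgr_to_ge cF); near=> n.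
have xn : - n.+1%:R <= x.
  rewrite lerNl; apply: (@le_trans _ _ n%:R); last by rewrite ler_nat.
  by near: n; exact: nbhs_infty_ger.
rewrite -lerN2; apply: (@is_derive_le (fun x => - F x) (fun x => - f x)) => // y /andP[_ yx].
- by apply: is_deriveN; apply: dF; exact: le_trans ax.
- by rewrite oppr_ge0 f0// (le_trans yx).
Unshelve. all: by end_near. Qed.

Lemma is_derive_lipschitz F f a b k : (forall x : R, is_derive x 1 F (f x)) ->
  (forall x, `|f x| <= k) -> `|F b - F a| <= k * `|b - a|.
Proof.
move=> dF fk; wlog ab : a b / a <= b => [H|].
  have /orP[] := le_total a b; first exact: H.
  by move=> ba; rewrite distrC [`|b - _|]distrC; exact: H.
have [|c _ ->] := @MVT_segment _ F f _ _ ab (fun x _ => dF x).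
  by apply: continuous_subspaceT; exact: is_derive_cont dF.
by rewrite normrM ler_wpM2r.
Qed.

Lemma Rintegral_derive0 F f : (forall x : R, is_derive x 1 F (f x)) ->
  continuous f -> mu.-integrable setT (EFin \o f) ->
  F n%:R @[n --> \oo] --> 0 -> F (- n%:R) @[n --> \oo] --> 0 ->
  (\int[mu]_x f x = 0)%R.
Proof.
move=> dF cf intf F0 FN0; have := cvg_Rintegral_sym intf.
have E : (fun n : nat => \int[mu]_(x in `[- n%:R, n%:R]) f x)%R =
    (fun n => F n%:R - F (- n%:R)).
  apply/funext => n; rewrite (is_derive_FTC dF)//.
  by rewrite (@le_trans _ _ 0)// lerNl oppr0.
rewrite E => H; have F00 : F n%:R - F (- n%:R) @[n --> \oo] --> 0.
  by rewrite -[X in _ --> X](subrr 0); exact: cvgB.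
exact: (cvg_unique (@Rhausdorff R) H F00).
Qed.

Lemma is_derive_mul F G (a b x : R) : is_derive x 1 F a -> is_derive x 1 G b ->
  is_derive x 1 (fun y => F y * G y) (a * G x + F x * b).
Proof.
move=> dF dG; apply: is_derive_eq (is_deriveM dF dG) _.
by rewrite addrC mulrC.
Qed.

Lemma is_derive_expR_comp F (a x : R) : is_derive x 1 F a ->
  is_derive x 1 (fun y => expR (F y)) (expR (F x) * a).
Proof. by move=> dF; exact: (@is_derive1_comp _ expR F). Qed.

(** The subgradient inequality at both ends of [x, x + h] squeezes the difference
quotient between [f x] and [f (x + h)], so continuity of the subgradient gives
differentiability. Subgradient inequalities pass to averages directly, which makes
averages of convex functions differentiable in a parameter. *)
Lemma is_derive_subgradient F f : (forall x z, F x + f x * (z - x) <= F z) ->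
  continuous f -> forall x : R, is_derive x 1 F (f x).
Proof.
move=> Ff cf x.
have cfx : f (h + x) @[h --> 0^'] --> f x.
  have c0 : h + x @[h --> (0 : R)] --> 0 + x.
    by apply: cvgD; [exact: cvg_id|exact: cvg_cst].
  rewrite add0r in c0; apply: (@cvg_comp _ _ _ (fun h => h + x) f _ (nbhs x)).
    exact: cvg_within_filter.
  exact: cf.
have H : (fun h : R => h^-1 *: ((F \o shift x) (h *: 1) - F x)) @ 0^' --> f x.
  apply/cvgrPdist_le => e e0.
  have /cvgrPdist_le/(_ e e0) cfe := cfx.
  near=> h.
  have h0 : h != 0 by near: h; exact: nbhs_dnbhs_neq.
  have fe : `|f x - f (h + x)| <= e by near: h.
  apply: le_trans fe; rewrite /= [h *: 1]mulr1 [_ *: _]mulrC.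
  have := Ff x (h + x); have := Ff (h + x) x.
  rewrite addrK opprD addrA addrAC subrr add0r mulrN => H1 H2.
  set q := (F (h + x) - F x) / h.
  have qh : F (h + x) - F x = q * h by rewrite /q divfK.
  have q1 : f x * h <= q * h by lra.
  have q2 : q * h <= f (h + x) * h by lra.
  have [hp|hn|h00] := ltgtP h 0; last by rewrite h00 eqxx in h0.
  - move: q1 q2; rewrite !ler_nM2r// => q1 q2.
    by rewrite !ger0_norm; lra.
  - move: q1 q2; rewrite !ler_pM2r// => q1 q2.
    by rewrite !ler0_norm; lra.
have dF : derivable F x 1 by apply/cvg_ex; exists (f x).
by apply: DeriveDef => //; apply: cvg_lim.
Unshelve. all: by end_near. Qed.

End whole_line.

(** * The centered Gaussian law on the line *)
Section gaussian.
Context {R : realType} (s : R).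
Hypothesis s_gt0 : 0 < s.
Local Notation mu := (@lebesgue_measure R).
Local Notation gam := (normal_pdf 0 s).
Implicit Types f g F G : R -> R.

(** Typed over the copy of the reals that carries Lebesgue measure. *)
Definition gauss : probability (measurableTypeR R) R := normal_prob 0 s.

Let s_neq0 : s != 0. Proof. by rewrite gt_eqF. Qed.

Lemma normal_pdf0E x :
  gam x = normal_peak s * expR (- (2 * s ^+ 2)^-1 * (x * x)).
Proof.
rewrite normal_pdfE// /normal_fun subr0; congr (_ * expR _).
by rewrite mulNr mulNr mulrC mulr_natl expr2.
Qed.

Lemma normal_pdf0_gt0 x : 0 < gam x.
Proof. by rewrite normal_pdf0E mulr_gt0 ?expR_gt0 ?normal_peak_gt0. Qed.

Lemma is_derive_normal_pdf (x : R) : is_derive x 1 gam (- (x / s ^+ 2) * gam x).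
Proof.
rewrite (_ : gam = fun x => normal_peak s * expR (- (2 * s ^+ 2)^-1 * (x * x))).
  have dxx := is_derive_mul (is_derive_id x 1) (is_derive_id x (1 : R)).
  have dexp := is_derive_expR_comp
    (is_derive_mul (is_derive_cst (- (2 * s ^+ 2)^-1) x 1) dxx).
  apply: is_derive_eq (is_derive_mul (is_derive_cst (normal_peak s) x 1) dexp) _.
  by rewrite /=; field.
by apply/funext => y; rewrite normal_pdf0E.
Qed.

(** The density is almost everywhere the Radon-Nikodym derivative, to which the
general change of measure formula applies. *)
Lemma ge0_integral_gauss (f : R -> \bar R) : measurable_fun setT f ->
  (forall x, 0 <= f x)%E ->
  (\int[gauss]_x f x = \int[mu]_x (f x * (gam x)%:E))%E.
Proof.
move=> mf f0; have dom := normal_prob_dominates 0 s.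
rewrite -(@Radon_Nikodym_SigmaFinite.change_of_variables _ _ _ gauss mu dom)//.
have intRN := Radon_Nikodym_SigmaFinite.f_integrable dom.
have mgam : measurable_fun setT (fun x => (gam x)%:E).
  by apply/measurable_EFinP; exact: measurable_normal_pdf.
apply: ae_eq_integral => //.
- by apply: emeasurable_funM => //; exact: measurable_int intRN.
- exact: emeasurable_funM.
- apply: ae_eqe_mul2l; apply: integral_ae_eq => // E _ mE.
  by rewrite -Radon_Nikodym_SigmaFinite.f_integral.
Qed.

Lemma integrable_gaussP (f : R -> R) : measurable_fun setT f ->
  gauss.-integrable setT (EFin \o f) <->
  mu.-integrable setT (EFin \o (fun x => f x * gam x)).
Proof.
move=> mf; have mf' : measurable_fun setT (fun x => (`|f x|)%:E).
  by apply/measurable_EFinP; exact: measurableT_comp.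
have mfg : measurable_fun setT (EFin \o (fun x => f x * gam x)).
  apply/measurable_EFinP; apply: measurable_funM => //.
  exact: measurable_normal_pdf.
have E : (\int[gauss]_x `|(f x)%:E| =
          \int[mu]_x `|(f x * gam x)%:E|)%E.
  rewrite ge0_integral_gauss//; apply: eq_integral => x _ /=.
  by rewrite normrM EFinM (ger0_norm (normal_pdf_ge0 _ _ _)).
by split => /integrableP[_ fi]; apply/integrableP; split => //;
  [rewrite -E|exact/measurable_EFinP|rewrite E].
Qed.

Lemma Rintegral_gauss (f : R -> R) : measurable_fun setT f ->
  (\int[gauss]_x f x = \int[mu]_x (f x * gam x))%R.
Proof.
move=> mf; rewrite /Rintegral; congr fine.
rewrite integralE [RHS]integralE.
have mEf : measurable_fun setT (EFin \o f) by exact/measurable_EFinP.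
rewrite !ge0_integral_gauss//; last 2 first.
- exact: measurable_funeneg.
- exact: measurable_funepos.
congr (_ - _)%E; apply: eq_integral => x _.
  by rewrite !funeposE maxe_pMl// ?mul0e// lee_fin normal_pdf_ge0.
by rewrite !funenegE maxe_pMl// ?mul0e ?EFinM ?muleN ?mulNe// lee_fin normal_pdf_ge0.
Qed.

(** Completing the square turns the integrand into a multiple of the density
centered at [t * s ^+ 2]. *)
Lemma integral_gauss_expR (t : R) :
  (\int[gauss]_x (expR (t * x))%:E = (expR (t ^+ 2 * s ^+ 2 / 2))%:E)%E.
Proof.
have E x : ((expR (t * x))%:E * (gam x)%:E =
   (expR (t ^+ 2 * s ^+ 2 / 2))%:E * (normal_pdf (t * s ^+ 2) s x)%:E)%E.
  rewrite normal_pdf0E normal_pdfE// /normal_fun -!EFinM; congr EFin.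
  rewrite !(mulrCA _ (normal_peak s)) -!expRD; congr (_ * expR _).
  by rewrite -mulr_natl; field.
rewrite ge0_integral_gauss; last 2 first.
- apply/measurable_EFinP; apply: measurableT_comp; first exact: measurable_expR.
  exact: measurable_funM.
- by move=> x; rewrite lee_fin expR_ge0.
under eq_integral do rewrite E.
rewrite ge0_integralZl//=.
- by rewrite integral_normal_pdf mule1.
- by apply/measurable_EFinP; exact: measurable_normal_pdf.
- by move=> x _; rewrite lee_fin normal_pdf_ge0.
Qed.

(** Elementary domination that makes Gaussian moments follow from the moment
generating function. *)
Lemma sqr_le_expR (y : R) : 0 <= y -> y ^+ 2 <= 4 * expR y.
Proof.
move=> y0; have := @expR_ge1Dx R (y / 2); have /= := expRD (y / 2) (y / 2).
by rewrite -splitr => ->; nra.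
Qed.

Lemma sqr_le_expRD (x : R) : x ^+ 2 <= 4 * (expR x + expR (- x)).
Proof.
have := expR_ge0 x; have := expR_ge0 (- x).
have [x0|x0] := leP 0 x; first by have := sqr_le_expR x0; lra.
have /sqr_le_expR : 0 <= - x by lra.
by rewrite sqrrN; lra.
Qed.

Lemma gauss_integrable_quad (f : R -> R) k : measurable_fun setT f ->
  (forall x, `|f x| <= k * (1 + x ^+ 2)) -> gauss.-integrable setT (EFin \o f).
Proof.
move=> mf fk.
have iexp t : gauss.-integrable setT (EFin \o (fun x => expR (t * x))).
  apply/integrableP; split.
    apply/measurable_EFinP; apply: measurableT_comp; first exact: measurable_expR.
    exact: measurable_funM.
  under eq_integral do rewrite /= ger0_norm ?expR_ge0//.
  by rewrite integral_gauss_expR ltry.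
have i0 := finite_measure_integrable_cst gauss (1 : R).
have i2 := integrableZl measurableT 4 (integrableD measurableT (iexp 1) (iexp (-1))).
have i1 := integrableZl measurableT `|k| (integrableD measurableT (i0 _ measurableT) i2).
apply: le_integrable i1 => //; first exact/measurable_EFinP.
move=> x _ /=; rewrite lee_fin; apply: le_trans (fk x) _.
rewrite ger0_norm; last first.
  by rewrite mulr_ge0// addr_ge0// mulr_ge0// addr_ge0 ?expR_ge0.
rewrite mul1r mulN1r; have := sqr_le_expRD x; have := sqr_ge0 x.
have := ler_norm k; have := normr_ge0 k; nra.
Qed.

Lemma normal_pdf0_decay (f : R -> R) k : (forall x, `|f x| <= k * (1 + x ^+ 2)) ->
  f n%:R * gam n%:R @[n --> \oo] --> 0 /\
  f (- n%:R) * gam (- n%:R) @[n --> \oo] --> 0.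
Proof.
move=> fk; pose c := `|k| * (normal_peak s * (32 * s ^+ 4)).
have H (x : R) : 1 <= `|x| -> `|f x * gam x| <= c * `|x|^-1.
  move=> x1; have x0 : 0 < `|x| by lra.
  rewrite normrM (ger0_norm (normal_pdf_ge0 _ _ _)) normal_pdf0E.
  set u := (2 * s ^+ 2)^-1 * (x * x).
  have x2 : 1 <= x ^+ 2 by rewrite -[x ^+ 2]real_normK ?num_real//; nra.
  have s2 : 0 < s ^+ 2 by rewrite exprn_gt0.
  have u0 : 0 < u.
    have x20 : 0 < x ^+ 2 by exact: lt_le_trans ltr01 x2.
    by rewrite /u -expr2; apply: mulr_gt0 => //; rewrite invr_gt0 mulr_gt0.
  have eu : expR (- u) <= 4 / u ^+ 2.
    rewrite expRN -[4 / _]invrK lef_pV2 ?posrE ?expR_gt0 ?invr_gt0 ?divr_gt0 ?exprn_gt0//.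
    by rewrite invf_div ler_pdivrMr// mulrC sqr_le_expR// ltW.
  rewrite mulNr -/u.
  have -> : c * `|x|^-1 = (`|k| * (2 * `|x| ^+ 3)) * (normal_peak s * (4 / u ^+ 2)).
    rewrite /u /c -expr2 -[x ^+ 2]real_normK ?num_real//.
    by field; rewrite s_neq0 gt_eqF.
  have p0 : 0 < normal_peak s by exact: normal_peak_gt0.
  apply: ler_pM => //; first by rewrite mulr_ge0 ?expR_ge0// ltW.
    apply: le_trans (fk x) _; rewrite -[x ^+ 2]real_normK ?num_real//.
    have k0 := normr_ge0 k; apply: (@le_trans _ _ (`|k| * (1 + `|x| ^+ 2))).
      by rewrite ler_wpM2r ?ler_norm// addr_ge0// sqr_ge0.
    by rewrite ler_wpM2l//; nra.
  by rewrite ler_pM2l.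
have cv : c * harmonic n @[n --> \oo] --> 0.
  by rewrite -[X in _ --> X](mulr0 c); apply: cvgMr; exact: cvg_harmonic.
have sq (g : nat -> R) : (forall n, `|g n| <= c * harmonic n) ->
    g n @[n --> \oo] --> 0.
  move=> gc; apply: norm_cvg0.
  apply: (@squeeze_cvgr _ _ _ _ (cst 0) (fun n => c * harmonic n)) => //.
    by apply: nearW => n; rewrite normr_ge0 gc.
  exact: cvg_cst.
split; rewrite -cvg_shiftS; apply: sq => n.
- by have := H n.+1%:R; rewrite normr_nat; apply; rewrite ler1n.
- by have := H (- n.+1%:R); rewrite normrN normr_nat; apply; rewrite ler1n.
Qed.

(** Gaussian integration by parts: [(f - x * F / s ^+ 2) * gam] is the derivative of
[F * gam], which vanishes at infinity. *)
Lemma gauss_derive0 (F f : R -> R) k : (forall x : R, is_derive x 1 F (f x)) ->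
  continuous f ->
  (forall x, `|F x| <= k * (1 + x ^+ 2)) ->
  (forall x, `|f x - x * F x / s ^+ 2| <= k * (1 + x ^+ 2)) ->
  (\int[gauss]_x (f x - x * F x / s ^+ 2) = 0)%R.
Proof.
move=> dF cf Fk fk; have cF := is_derive_cont dF.
have ch : continuous (fun x => f x - x * F x / s ^+ 2).
  move=> x; apply: cvgB; first exact: cf.
  apply: cvgMl; apply: cvgM; [exact: cvg_id|exact: cF].
have mh : measurable_fun setT (fun x => f x - x * F x / s ^+ 2).
  exact: continuous_measurable_fun.
have ih := gauss_integrable_quad mh fk.
have [c1 c2] := normal_pdf0_decay Fk.
rewrite Rintegral_gauss//.
apply: (@Rintegral_derive0 _ (fun x => F x * gam x)) => //.
- move=> x; apply: is_derive_eq (is_derive_mul (dF x) (is_derive_normal_pdf x)) _.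
  by rewrite mulrBl; congr (_ + _); ring.
- move=> x; apply: cvgM; first exact: ch.
  exact: continuous_normal_pdf.
- exact/integrable_gaussP.
Qed.

End gaussian.

Lemma Rintegral_prob_cst d (T : measurableType d) (R : realType)
  (P : probability T R) (c : R) : (\int[P]_x c = c)%R.
Proof. by rewrite Rintegral_cst// [X in fine X](probability_setT P) mulr1. Qed.

(** * Polynomial growth *)
Section growth.
Context {R : realType}.
Implicit Types f g : R -> R.

(** Powers of [1 + `|x|] make the class stable under sums and products with
exponents that add up; exponent [2] is what Gaussian integrability requires. *)
Definition growth (d : nat) f := exists k, forall x, `|f x| <= k * (1 + `|x|) ^+ d.

Lemma growth_cst c : growth 0 (fun=> c).
Proof. by exists `|c| => x; rewrite expr0 mulr1. Qed.

Lemma growth_id : growth 1 id.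
Proof. by exists 1 => x; rewrite mul1r expr1 lerDr. Qed.

Lemma growthS d f : growth d f -> growth d.+1 f.
Proof.
move=> [k fk]; exists k => x; apply: le_trans (fk x) _.
have k0 : 0 <= k.
  by have := le_trans (normr_ge0 _) (fk 0); rewrite normr0 addr0 expr1n mulr1.
by rewrite ler_wpM2l// exprS ler_peMl ?lerDl// exprn_ge0// addr_ge0.
Qed.

Lemma growthD d f g : growth d f -> growth d g -> growth d (fun x => f x + g x).
Proof.
move=> [k fk] [l gl]; exists (k + l) => x.
by rewrite mulrDl (le_trans (ler_normD _ _))// lerD.
Qed.

Lemma growthM d e f g : growth d f -> growth e g ->
  growth (d + e) (fun x => f x * g x).
Proof.
move=> [k fk] [l gl]; exists (k * l) => x.
by rewrite normrM exprD mulrACA ler_pM.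
Qed.

Lemma growthZ d f c : growth d f -> growth d (fun x => c * f x).
Proof. by move=> fd; exact: growthM (growth_cst c) fd. Qed.

Lemma growthN d f : growth d f -> growth d (fun x => - f x).
Proof. by move=> [k fk]; exists k => x; rewrite normrN. Qed.

Lemma growthB d f g : growth d f -> growth d g -> growth d (fun x => f x - g x).
Proof. by move=> fd gd; apply: growthD => //; exact: growthN. Qed.

Lemma growth2 f : growth 2 f -> exists k, forall x, `|f x| <= k * (1 + x ^+ 2).
Proof.
move=> [k fk]; exists (2 * k) => x; apply: le_trans (fk x) _.
have k0 : 0 <= k.
  by have := le_trans (normr_ge0 _) (fk 0); rewrite normr0 addr0 expr1n mulr1.
rewrite -[x ^+ 2]real_normK ?num_real// [2 * k]mulrC -mulrA ler_wpM2l//.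
by have := sqr_ge0 (`|x| - 1); nra.
Qed.

End growth.

(** * Stein's equation for a convex function *)
Section stein.
Context {R : realType} (s : R).
Hypothesis s_gt0 : 0 < s.
Local Notation mu := (@lebesgue_measure R).
Local Notation gam := (normal_pdf 0 s).
Local Notation gauss := (gauss s).

Lemma growth_gauss_integrable (f : R -> R) : measurable_fun setT f ->
  growth 2 f -> gauss.-integrable setT (EFin \o f).
Proof. by move=> mf /growth2[k fk]; exact: gauss_integrable_quad fk. Qed.

Lemma gauss_derive0_growth (F f : R -> R) : (forall x : R, is_derive x 1 F (f x)) ->
  continuous f -> growth 2 F -> growth 2 (fun x => f x - x * F x / s ^+ 2) ->
  (\int[gauss]_x (f x - x * F x / s ^+ 2) = 0)%R.
Proof.
move=> dF cf /growth2[k Fk] /growth2[l fl].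
apply: (@gauss_derive0 _ _ s_gt0 _ _ (Num.max k l)) => // x.
- by rewrite (le_trans (Fk x))// ler_wpM2r ?addr_ge0 ?sqr_ge0// le_max lexx.
- by rewrite (le_trans (fl x))// ler_wpM2r ?addr_ge0 ?sqr_ge0// le_max lexx orbT.
Qed.

Lemma Rintegral_gauss_id : (\int[gauss]_x x = 0)%R.
Proof.
have ic := @growth_gauss_integrable id (@measurable_id _ _ _) (growthS growth_id).
have := @gauss_derive0_growth (fun=> 1) (fun=> 0) (fun x => is_derive_cst _ _ _).
under eq_Rintegral do rewrite mulr1 sub0r -mulrN.
move=> /(_ _ _ _)/wrap[].
- by move=> x; exact: cvg_cst.
- exact/growthS/growthS/growth_cst.
- apply: growthS; apply: growthB; first exact/growthS/growth_cst.
  exact: (growthM (growthM growth_id (growth_cst 1)) (growth_cst (s ^+ 2)^-1)).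
- rewrite RintegralZr// => /eqP; rewrite mulf_eq0 => /orP[/eqP//|].
  by rewrite oppr_eq0 invr_eq0 gt_eqF// exprn_gt0.
Qed.

Variables (m b : R -> R) (L : R).
Hypothesis mb : forall x z, m x + b x * (z - x) <= m z.
Hypothesis bL : forall x, `|b x| <= L.
Hypothesis cb : continuous b.

Let M := (\int[gauss]_x m x)%R.
Let mbar x := m x - M.

Lemma is_derive_m (x : R) : is_derive x 1 m (b x).
Proof. exact: is_derive_subgradient. Qed.

Let cm : continuous m. Proof. exact: is_derive_cont is_derive_m. Qed.

Let mm : measurable_fun setT m. Proof. exact: continuous_measurable_fun. Qed.

Lemma growth_subgradient : growth 1 m.
Proof.
exists (`|m 0| + L) => x; rewrite expr1.
have := is_derive_lipschitz 0 x is_derive_m bL; rewrite subr0 => H.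
have L0 : 0 <= L by exact: le_trans (bL 0).
rewrite -[m x](subrK (m 0)) (le_trans (ler_normD _ _))//.
have := normr_ge0 (m 0); have := normr_ge0 x; nra.
Qed.

Let im : gauss.-integrable setT (EFin \o m).
Proof. exact: growth_gauss_integrable (growthS growth_subgradient). Qed.

Lemma growth_centered : growth 1 mbar.
Proof. by apply: growthB growth_subgradient _; exact/growthS/growth_cst. Qed.

Let c_mbar : continuous mbar.
Proof. by move=> x; apply: cvgB; [exact: cm|exact: cvg_cst]. Qed.

(** Jensen's inequality, from the tangent line of [m] at the mean [0] of [gauss]. *)
Lemma value0_le_mean : m 0 <= M.
Proof.
have i1 := finite_measure_integrable_cst gauss (m 0) measurableT.
have ix := @growth_gauss_integrable id (@measurable_id _ _ _) (growthS growth_id).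
have i2 := integrableZl measurableT (b 0) ix.
have <- : (\int[gauss]_x (m 0 + b 0 * x) = m 0)%R.
  rewrite RintegralD// RintegralZl// Rintegral_gauss_id mulr0 addr0.
  by rewrite Rintegral_prob_cst.
apply: le_Rintegral => //; first exact: (integrableD measurableT i1 i2).
by move=> x _; have := mb 0 x; rewrite subr0.
Qed.

Let h x := mbar x * gam x.

Let ch : continuous h.
Proof.
move=> x; apply: cvgM; first exact: c_mbar.
by apply: continuous_normal_pdf; rewrite gt_eqF.
Qed.

Let m_mbar : measurable_fun setT mbar. Proof. exact: continuous_measurable_fun. Qed.

Let ih : mu.-integrable setT (EFin \o h).
Proof.
have H := growth_gauss_integrable m_mbar (growthS growth_centered).
have := (integrable_gaussP s m_mbar).1 H.
by [].
Qed.

Let Rintegral_h : (\int[mu]_x h x = 0)%R.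
Proof.
rewrite -Rintegral_gauss// RintegralB//; last exact: finite_measure_integrable_cst.
by rewrite Rintegral_prob_cst subrr.
Qed.

(** Minus the quotient of [I] by the density solves Stein's equation. *)
Let I x := (\int[mu]_(t in `]-oo, x]) h t)%R.

Let dI (x : R) : is_derive x 1 I (h x).
Proof.
have xx1 : x < x + 1 by rewrite ltrDl.
have ihx : mu.-integrable [set` Interval -oo%O (BRight (x + 1))] (EFin \o h).
  exact: integrableS ih.
have [dF Fh] := continuous_FTC1 xx1 ihx (ltNyr x) (@ch x).
apply: DeriveDef; first exact: dF.
by rewrite -derive1E; exact: Fh.
Qed.

Let I_cvgNy : I (- n%:R) @[n --> \oo] --> 0.
Proof. exact: cvg_Rintegral_Ny. Qed.

Let I_cvgy : I n%:R @[n --> \oo] --> 0.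
Proof.
have H : I n%:R - I (- n%:R) @[n --> \oo] --> 0.
  have := cvg_Rintegral_sym ih; rewrite Rintegral_h.
  suff -> : (fun n : nat => \int[mu]_(x in `[- n%:R, n%:R]) h x)%R =
     (fun n => I n%:R - I (- n%:R)) by [].
  apply/funext => n; rewrite (is_derive_FTC dI)//.
  by rewrite (@le_trans _ _ 0)// lerNl oppr0.
rewrite (_ : (fun n : nat => I n%:R) =
    (fun n => I n%:R - I (- n%:R) + I (- n%:R))); last first.
  by apply/funext => n; rewrite subrK.
by rewrite -[X in _ --> X](addr0 0); exact: cvgD.
Qed.


(** With [V = - I / gam] below, [gam * V' = K]. *)
Let K x := - (x * I x / s ^+ 2) - h x.

Let v_gt0 : 0 < s ^+ 2. Proof. by rewrite exprn_gt0. Qed.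

(** The quotient [K / x] is used because its derivative is [gam / x ^+ 2] times
[mbar x - x * b x], whose sign is known on the whole line by [mbar_le], whereas
the derivative of [K] still involves [I]. *)
Let dKx (x : R) : x != 0 -> is_derive x 1 (fun y => - (I y / s ^+ 2) - h y * y^-1)
  (gam x * (mbar x - x * b x) / x ^+ 2).
Proof.
move=> x0.
have dm : is_derive x 1 mbar (b x).
  apply: is_derive_eq (is_deriveB (is_derive_m x) (is_derive_cst M x 1)) _.
  by rewrite subr0.
have dh := is_derive_mul dm (is_derive_normal_pdf s_gt0 x).
have dV : is_derive x 1 (fun y : R => y^-1) (- x ^- 2).
  apply: is_derive_eq (@is_deriveV _ id x 1 1 x0 (is_derive_id x 1)) _.
  by rewrite [_ *: _]mulr1.
have dIv := is_derive_mul (dI x) (is_derive_cst (s ^+ 2)^-1 x 1).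
apply: is_derive_eq (is_deriveB (is_deriveN dIv) (is_derive_mul dh dV)) _.
by rewrite /h /=; field; rewrite x0 gt_eqF.
Qed.

Let h_cvg : h n%:R @[n --> \oo] --> 0 /\ h (- n%:R) @[n --> \oo] --> 0.
Proof.
have [k mk] := growth2 (growthS growth_centered).
exact: normal_pdf0_decay mk.
Qed.

(** The tangent line of [m] at [x] passes below [m 0], and [m 0] is at most the
mean. *)
Let mbar_le x : mbar x - x * b x <= 0.
Proof. by have := mb x 0; have := value0_le_mean; rewrite /mbar; lra. Qed.

(** [K / x] is decreasing on each half-line and tends to [0] at infinity, so it has
the sign of [x]. *)
Let K_ge0 x : 0 <= K x.
Proof.
have [hy hNy] := h_cvg.
have [->|x0] := eqVneq x 0.
  rewrite /K mul0r mul0r oppr0 sub0r oppr_ge0 /h.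
  rewrite mulr_le0_ge0 ?normal_pdf_ge0//.
  by have := mbar_le 0; rewrite mul0r subr0.
pose F y := - (I y / s ^+ 2) - h y * y^-1.
have KF : K x = x * F x by rewrite /K /F; field; rewrite x0 gt_eqF.
have f0 y : gam y * (mbar y - y * b y) / y ^+ 2 <= 0.
  by rewrite mulr_le0_ge0 ?invr_ge0 ?sqr_ge0// mulr_ge0_le0// normal_pdf_ge0.
have [xn|xp] := ltP x 0; last first.
  have {}xp : 0 < x by rewrite lt_neqAle eq_sym x0.
  rewrite KF; apply: mulr_ge0; first exact: ltW.
  apply: (is_derive_ge0_cvgy (F := F) (a := x)
    (f := fun y => gam y * (mbar y - y * b y) / y ^+ 2)) => //.
    by move=> y xy; apply: dKx; rewrite gt_eqF// (lt_le_trans xp).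
  have -> : 0 = - (0 / s ^+ 2) - 0 * 0 :> R by rewrite !mul0r !oppr0 addr0.
  apply: cvgB.
    apply: cvgN; apply: cvgMl.
    by move: I_cvgy; rewrite -cvg_shiftS.
  apply: cvgM; last exact: cvg_harmonic.
  by move: hy; rewrite -cvg_shiftS.
rewrite KF; apply: mulr_le0; first exact: ltW.
apply: (is_derive_le0_cvgNy (F := F) (a := x)
  (f := fun y => gam y * (mbar y - y * b y) / y ^+ 2)) => //.
  by move=> y xy; apply: dKx; rewrite lt_eqF// (le_lt_trans xy).
have -> : 0 = - (0 / s ^+ 2) - 0 * - 0 :> R by rewrite !mul0r !oppr0 addr0.
apply: cvgB.
  apply: cvgN; apply: cvgMl.
  by move: I_cvgNy; rewrite -cvg_shiftS.
apply: cvgM; first by move: hNy; rewrite -cvg_shiftS.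
under eq_fun do rewrite invrN.
by apply: cvgN; exact: cvg_harmonic.
Qed.

Let V x := - I x / gam x.

Let V' x := x * V x / s ^+ 2 - mbar x.

Let dV (x : R) : is_derive x 1 V (V' x).
Proof.
have g0 : gam x != 0 by rewrite gt_eqF// normal_pdf0_gt0.
have dg := is_deriveV g0 (is_derive_normal_pdf s_gt0 x).
apply: is_derive_eq (is_derive_mul (is_deriveN (dI x)) dg) _.
rewrite /V' /V /h -[_ *: _]/(_ * _) -[(- I) x]/(- I x).
by field; rewrite g0 gt_eqF.
Qed.

Let V'_ge0 x : 0 <= V' x.
Proof.
have g0 : 0 < gam x by rewrite normal_pdf0_gt0.
have -> : V' x = K x / gam x.
  by rewrite /V' /V /K /h; field; rewrite !gt_eqF.
by rewrite divr_ge0// ltW.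
Qed.

Let V_homo x y : x <= y -> V x <= V y.
Proof. by move=> xy; apply: (is_derive_le xy) => // z _; exact: dV. Qed.

(** Outside [-1, 1] the integral [I] is compared with a multiple of [gam], the sign
of the derivative of [e * I + c * gam] being known there for [e = 1, -1]; the
monotonicity of [V] handles the middle. *)
Let V_bounded : exists c, forall x, `|V x| <= c.
Proof.
have [k mk] := growth_centered.
have k0 : 0 <= k.
  by have := le_trans (normr_ge0 _) (mk 0); rewrite normr0 addr0 expr1n mulr1.
pose c := 2 * k * s ^+ 2.
have [hy hNy] : gam n%:R @[n --> \oo] --> 0 /\ gam (- n%:R) @[n --> \oo] --> 0.
  have [] := @normal_pdf0_decay _ _ s_gt0 (fun=> 1) 1.
    by move=> x; rewrite normr1 mul1r lerDl sqr_ge0.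
  by move=> H1 H2; split; [move: H1|move: H2]; under eq_fun do rewrite mul1r.
have dIg e (x : R) : is_derive x 1 (fun x => e * I x + c * gam x)
    (gam x * (e * mbar x - 2 * k * x)).
  apply: is_derive_eq (is_deriveD (is_derive_mul (is_derive_cst e x 1) (dI x))
    (is_derive_mul (is_derive_cst c x 1) (is_derive_normal_pdf s_gt0 x))) _.
  by rewrite /c /h /=; field; rewrite gt_eqF.
have cy e : e * I n.+1%:R + c * gam n.+1%:R @[n --> \oo] --> 0.
  have : e * I n.+1%:R + c * gam n.+1%:R @[n --> \oo] --> e * 0 + c * 0.
    apply: cvgD; apply: cvgMr.
      by move: I_cvgy; rewrite -cvg_shiftS.
    by move: hy; rewrite -(cvg_shiftS (fun n => gam n%:R)).
  by rewrite !mulr0 addr0.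
have cNy e : e * I (- n.+1%:R) + c * gam (- n.+1%:R) @[n --> \oo] --> 0.
  have : e * I (- n.+1%:R) + c * gam (- n.+1%:R) @[n --> \oo] --> e * 0 + c * 0.
    apply: cvgD; apply: cvgMr.
      by move: I_cvgNy; rewrite -cvg_shiftS.
    by move: hNy; rewrite -(cvg_shiftS (fun n => gam (- n%:R))).
  by rewrite !mulr0 addr0.
have bdy e x : `|e| <= 1 -> 1 <= x -> 0 <= e * I x + c * gam x.
  move=> e1 x1; apply: (is_derive_ge0_cvgy (fun y _ => dIg e y) _ (cy e)) x1 => y y1.
  rewrite mulr_ge0_le0 ?normal_pdf_ge0// subr_le0 (le_trans (ler_norm _))// normrM.
  have := mk y; rewrite expr1 (ger0_norm (le_trans ler01 y1)).
  by have := normr_ge0 (mbar y); nra.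
have bdNy e x : `|e| <= 1 -> x <= -1 -> - (e * I x + c * gam x) <= 0.
  move=> e1 x1.
  have dN (y : R) : is_derive y 1 (fun x => - (e * I x + c * gam x))
      (- (gam y * (e * mbar y - 2 * k * y))).
    exact: is_deriveN.
  apply: (is_derive_le0_cvgNy (fun y _ => dN y) _ _) x1 => [y y1|]; last first.
    by rewrite -[X in _ --> X]oppr0; apply: cvgN; exact: cNy.
  rewrite oppr_le0 mulr_ge0 ?normal_pdf_ge0//.
  have := mk y; rewrite expr1 (_ : `|y| = - y); last by rewrite ler0_norm; lra.
  have : - (e * mbar y) <= `|mbar y|.
    rewrite (le_trans (ler_norm _))// normrN normrM.
    by have := normr_ge0 (mbar y); nra.
  by nra.
have bd x : 1 <= `|x| -> `|V x| <= c.
  have gx := normal_pdf0_gt0 s_gt0 x.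
  rewrite /V normrM normrN normfV (gtr0_norm gx) ler_pdivrMr// ler_norml.
  rewrite ler_normr => /orP[x1|x1].
  - have := bdy 1 x; have := bdy (-1) x; rewrite normrN normr1 => /(_ (lexx _) x1) ? /(_ (lexx _) x1) ?.
    by apply/andP; split; lra.
  - have x1' : x <= -1 by lra.
    have := bdNy 1 x; have := bdNy (-1) x; rewrite normrN normr1.
    move=> /(_ (lexx _) x1') ? /(_ (lexx _) x1') ?.
    by apply/andP; split; lra.
have L1 x : x <= -1 -> - c <= V x.
  by move=> x1; have := bd x; rewrite ler_normr ler_norml => /(_ _)/andP[]//; apply/orP; right; lra.
have L2 x : 1 <= x -> V x <= c.
  by move=> x1; have := bd x; rewrite ler_normr ler_norml => /(_ _)/andP[]//; apply/orP; left.
exists c => x; rewrite ler_norml; apply/andP; split.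
- apply: (@le_trans _ _ (V (Num.min x (-1)))); last by rewrite V_homo// ge_min lexx.
  by rewrite L1// ge_min lexx orbT.
- apply: (@le_trans _ _ (V (Num.max x 1))); first by rewrite V_homo// le_max lexx.
  by rewrite L2// le_max lexx orbT.
Qed.

(** The nonnegativity of [V'] is where convexity of [m] enters. *)
Lemma stein_solution : exists V V' : R -> R,
  [/\ forall x : R, is_derive x 1 V (V' x),
      forall x, V' x = x * V x / s ^+ 2 - (m x - \int[gauss]_y m y)%R,
      forall x, 0 <= V' x & exists c, forall x, `|V x| <= c].
Proof. by exists V, V'; split => //. Qed.

End stein.

(** * The variance inequality in one dimension *)
Section one_dimension.
Context {R : realType}.

(** [(1 + x) * expR (x ^+ 2 / 2 - x)] equals [1] at [0] and has derivative
[x ^+ 2 * expR (x ^+ 2 / 2 - x)]. *)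
Lemma expR_le1D (v : R) : 0 <= v -> expR (v - v ^+ 2 / 2) <= 1 + v.
Proof.
move=> v0; pose F (x : R) := (1 + x) * expR (x * x / 2 - x).
have dF (x : R) : is_derive x 1 F (x ^+ 2 * expR (x * x / 2 - x)).
  have did := is_derive_id x (1 : R).
  have dq := is_deriveB (is_derive_mul (is_derive_mul did did) (is_derive_cst (2^-1 : R) x 1)) did.
  apply: is_derive_eq (is_derive_mul (is_deriveD (is_derive_cst (1 : R) x 1) did)
    (is_derive_expR_comp dq)) _.
  rewrite -![(_ - _ : _ -> _) _]/(_ - _) -![(_ + _ : _ -> _) _]/(_ + _) /=.
  by field.
have : F 0 <= F v.
  apply: (is_derive_le v0 (fun x _ => dF x)) => x _.
  by rewrite mulr_ge0 ?sqr_ge0 ?expR_ge0.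
rewrite /F addr0 mul1r !mul0r subrr expR0 -expr2.
rewrite -[v - _]opprB expRN -[X in X <= _ -> _]mul1r => H.
by rewrite -[leLHS]mul1r ler_pdivrMr ?expR_gt0// -[leLHS]mul1r.
Qed.

Variable s : R.
Hypothesis s_gt0 : 0 < s.
Local Notation mu := (@lebesgue_measure R).
Local Notation gam := (normal_pdf 0 s).
Local Notation gauss := (gauss s).

(** [U] plays the role of the exponential of a convex function lying above
[m + C]. It is compared with [m] at two distinct points [x] and [z], which
allows [z = x + V x] with [V] the solution of Stein's equation for [m]. For [C = 0]
and [U = expR \o m] the conclusion reads
[E[m] + Var m / 2 <= ln E[expR m]]. *)
Lemma gauss_variance_le (m b C U : R -> R) (L : R) :
  (forall x z, m x + b x * (z - x) <= m z) -> (forall x, `|b x| <= L) ->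
  continuous b ->
  measurable_fun setT C -> growth 2 C ->
  continuous U -> (forall z, 0 <= U z) ->
  gauss.-integrable setT (EFin \o U) ->
  (forall x z, expR (m x + C x + b x * (z - x)) <= U z) ->
  expR ((\int[gauss]_x m x) + (\int[gauss]_x C x) +
        ((\int[gauss]_x (m x ^+ 2)) - (\int[gauss]_x m x) ^+ 2) / 2)%R
  <= (\int[gauss]_x U x)%R.
Proof.
move=> mb bL cb mC C2 cU U0 iU mCU.
have [V [V' [dV V'E V'0 [c Vc]]]] := stein_solution s_gt0 mb bL cb.
set M := (\int[gauss]_x m x)%R in V'E *; set MC := (\int[gauss]_x C x)%R.
set M2 := (\int[gauss]_x _ ^+ 2)%R; set c0 := (X in expR X).
have v0 : s ^+ 2 != 0 by rewrite gt_eqF// exprn_gt0.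
have dm := is_derive_subgradient mb cb.
have cm := is_derive_cont dm.
have m1 := growth_subgradient mb bL cb.
have b0 : growth 0 b by exists L => x; rewrite mulr1.
have V0 : growth 0 V by exists c => x; rewrite mulr1.
have mbar1 : growth 1 (fun x => m x - M) by apply: growthB m1 _; exact/growthS/growth_cst.
have V'1 : growth 1 V'.
  rewrite (_ : V' = fun x => x * V x * (s ^+ 2)^-1 - (m x - M)); last exact/funext.
  apply: growthB mbar1.
  exact: growthM (growthM growth_id V0) (growth_cst (s ^+ 2)^-1).
have cV := is_derive_cont dV.
have cV' : continuous V'.
  rewrite (_ : V' = fun x => x * V x * (s ^+ 2)^-1 - (m x - M)); last exact/funext.
  move=> x; apply: cvgB; last by apply: cvgB; [exact: cm|exact: cvg_cst].
  by apply: cvgMl; apply: cvgM; [exact: cvg_id|exact: cV].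
(* What the shift gains to first order minus its quadratic cost. *)
pose B x := V x * b x - V x ^+ 2 / (2 * s ^+ 2) - V' x ^+ 2 / 2.
have B2 : growth 2 B.
  apply: growthB; last first.
    exact: (growthM (growthM V'1 V'1) (growth_cst 2^-1)).
  apply: growthB; apply: growthS; apply: growthS.
    exact: growthM V0 b0.
  exact: (growthM (growthM V0 V0) (growth_cst (2 * s ^+ 2)^-1)).
have cB : continuous B.
  move=> x; apply: cvgB; [apply: cvgB|].
  - by apply: cvgM; [exact: cV|exact: cb].
  - by apply: cvgMl; apply: cvgM; exact: cV.
  - by apply: cvgMl; apply: cvgM; exact: cV'.
have mB : measurable_fun setT B by exact: continuous_measurable_fun.
have mm : measurable_fun setT m by exact: continuous_measurable_fun.
have iB := growth_gauss_integrable s_gt0 mB B2.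
have iC := growth_gauss_integrable s_gt0 mC C2.
have im := growth_gauss_integrable s_gt0 mm (growthS m1).
have im2 : gauss.-integrable setT (EFin \o (fun x => m x ^+ 2)).
  apply: (growth_gauss_integrable s_gt0); first exact: measurable_funX.
  exact: (growthM m1 m1).
have imb2 : gauss.-integrable setT (EFin \o (fun x => (m x - M) * (m x - M) / 2)).
  apply: (growth_gauss_integrable s_gt0).
    by apply: continuous_measurable_fun => x; apply: cvgMl;
      apply: cvgM; apply: cvgB (cvg_cst _); exact: cm.
  exact: (growthM (growthM mbar1 mbar1) (growth_cst 2^-1)).
have Emb2 : (\int[gauss]_x ((m x - M) * (m x - M) / 2) = (M2 - M ^+ 2) / 2)%R.
  have -> : (fun x => (m x - M) * (m x - M) / 2) =
            (fun x => (m x ^+ 2 * 2^-1 - M * m x) + M ^+ 2 / 2).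
    by apply/funext => x; field.
  have i1 := integrableZr measurableT 2^-1 im2.
  have i2 := integrableZl measurableT M im.
  have i3 := integrableB measurableT i1 i2.
  rewrite RintegralD//; last exact: finite_measure_integrable_cst.
  rewrite RintegralB// RintegralZr// RintegralZl// Rintegral_prob_cst.
  by rewrite -/M -/M2; field.
(* Integration by parts for V * (mbar - V') / 2, with V' replaced by its value from
   Stein's equation so that only V and m are differentiated. *)
have EB : (\int[gauss]_x B x = (M2 - M ^+ 2) / 2)%R.
  pose F x := V x * (2 * (m x - M) - x * V x * (s ^+ 2)^-1) * 2^-1.
  pose f x := (V' x * (2 * (m x - M) - x * V x * (s ^+ 2)^-1) +
    V x * (2 * b x - (V x + x * V' x) * (s ^+ 2)^-1)) * 2^-1.
  have dF (x : R) : is_derive x 1 F (f x).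
    have did := is_derive_id x (1 : R).
    have dmb := is_deriveB (dm x) (is_derive_cst M x 1).
    have dxV := is_derive_mul (is_derive_mul did (dV x)) (is_derive_cst (s ^+ 2)^-1 x 1).
    have d1 := is_deriveB (is_derive_mul (is_derive_cst (2 : R) x 1) dmb) dxV.
    apply: is_derive_eq (is_derive_mul (is_derive_mul (dV x) d1) (is_derive_cst (2^-1 : R) x 1)) _.
    rewrite /f -![(_ - _ : _ -> _) _]/(_ - _) /=.
    by field; rewrite gt_eqF.
  have fE x : f x - x * F x / s ^+ 2 = B x - (m x - M) * (m x - M) / 2.
    rewrite /f /F /B; have := V'E x.
    move=> VE; have -> : m x = x * V x / s ^+ 2 - V' x + M by rewrite VE; ring.
    by field; rewrite gt_eqF.
  have F2 : growth 2 F.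
    apply: (growthM (d := 2) (e := 0)); last exact: growth_cst.
    apply: (growthS (d := 1)); apply: (growthM (d := 0) (e := 1) V0).
    apply: growthB; first exact: growthZ.
    exact: (growthM (growthM growth_id V0) (growth_cst (s ^+ 2)^-1)).
  have cf : continuous f.
    move=> x; apply: cvgMl; apply: cvgD; apply: cvgM.
    - exact: cV'.
    - apply: cvgB; first by apply: cvgMr; apply: cvgB (cvg_cst _); exact: cm.
      by apply: cvgMl; apply: cvgM; [exact: cvg_id|exact: cV].
    - exact: cV.
    - apply: cvgB; first by apply: cvgMr; exact: cb.
      apply: cvgMl; apply: cvgD; first exact: cV.
      by apply: cvgM; [exact: cvg_id|exact: cV'].
  have := gauss_derive0_growth s_gt0 dF cf F2.
  rewrite (_ : (fun x => f x - x * F x / s ^+ 2) =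
    (fun x => B x - (m x - M) * (m x - M) / 2)); last exact/funext.
  move=> /(_ _)/wrap[].
    apply: growthB => //.
    exact: (growthM (growthM mbar1 mbar1) (growth_cst 2^-1)).
  by rewrite RintegralB// Emb2 => /eqP; rewrite subr_eq0 => /eqP.
pose A x := M + C x + B x.
have iMC : gauss.-integrable setT (EFin \o (fun x => M + C x)).
  exact: (integrableD measurableT (finite_measure_integrable_cst gauss M measurableT) iC).
have iA : gauss.-integrable setT (EFin \o A).
  exact: (integrableD measurableT iMC iB).
have EA : (\int[gauss]_x A x = c0)%R.
  rewrite RintegralD// RintegralD//; last exact: finite_measure_integrable_cst.
  by rewrite Rintegral_prob_cst EB.
have mA : measurable_fun setT A by apply/measurable_EFinP; exact: measurable_int iA.
pose T x := x + V x.
have dT (x : R) : is_derive x 1 T (1 + V' x).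
  exact: is_deriveD.
pose G x := U x * gam x.
have cG : continuous G.
  by move=> x; apply: cvgM; [exact: cU|apply: continuous_normal_pdf; rewrite gt_eqF].
pose w x := G (T x) * (1 + V' x).
have cw : continuous w.
  move=> x; apply: cvgM.
    by apply: (@cvg_comp _ _ _ T G); [exact: (is_derive_cont dT)|exact: cG].
  by apply: cvgD; [exact: cvg_cst|exact: cV'].
pose g x := expR c0 * (1 + (A x - c0)) * gam x.
(* The tangent of the exponential at c0 replaces Jensen's inequality and makes the
   lower bound integrable. *)
have gw x : g x <= w x.
  have gT : gam (T x) = gam x * expR (- (x * V x / s ^+ 2) - V x ^+ 2 / (2 * s ^+ 2)).
    rewrite !normal_pdf0E// -[RHS]mulrA -expRD /T; congr (_ * expR _).
    by field; rewrite gt_eqF.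
  rewrite /g /w /G gT.
  apply: (@le_trans _ _ (expR (A x) * gam x)).
    have -> : expR (A x) = expR c0 * expR (A x - c0) by rewrite -expRD addrC subrK.
    by rewrite ler_wpM2r ?normal_pdf_ge0// ler_wpM2l ?expR_ge0// expR_ge1Dx.
  have -> : A x = (m x + C x + b x * (T x - x)) +
     (- (x * V x / s ^+ 2) - V x ^+ 2 / (2 * s ^+ 2)) + (V' x - V' x ^+ 2 / 2).
    by rewrite /A /B /T; have := V'E x => ->; field; rewrite gt_eqF.
  have Ua := mCU x (T x); have Ve := expR_le1D (V'0 x).
  rewrite 2!expRD (_ : _ * gam x = expR (m x + C x + b x * (T x - x)) *
    (gam x * expR (- (x * V x / s ^+ 2) - V x ^+ 2 / (2 * s ^+ 2))) *
    expR (V' x - V' x ^+ 2 / 2)); last by ring.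
  have gx := normal_pdf_ge0 0 s x.
  by rewrite !ler_pM ?mulr_ge0 ?expR_ge0.
pose g0 x := expR c0 * (1 + (A x - c0)).
have iAc : gauss.-integrable setT (EFin \o (fun x => A x - c0)).
  exact: (integrableB measurableT iA (finite_measure_integrable_cst gauss c0 measurableT)).
have i1A : gauss.-integrable setT (EFin \o (fun x => 1 + (A x - c0))).
  exact: (integrableD measurableT (finite_measure_integrable_cst gauss 1 measurableT) iAc).
have ig0 : gauss.-integrable setT (EFin \o g0).
  exact: (integrableZl measurableT (expR c0) i1A).
have mg0 : measurable_fun setT g0 by apply/measurable_EFinP; exact: measurable_int ig0.
have intg : mu.-integrable setT (EFin \o g).
  have := (integrable_gaussP s mg0).1 ig0.
  by [].
have Eg : (\int[mu]_x g x = expR c0)%R.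
  rewrite -(Rintegral_gauss s mg0) RintegralZl// RintegralD//; last first.
    exact: finite_measure_integrable_cst.
  rewrite RintegralB//; last exact: finite_measure_integrable_cst.
  by rewrite !Rintegral_prob_cst EA subrr addr0 mulr1.
have mU : measurable_fun setT U by exact: continuous_measurable_fun.
have intG : mu.-integrable setT (EFin \o G).
  have := (integrable_gaussP s mU).1 iU.
  by [].
have EG : (\int[mu]_x G x = \int[gauss]_x U x)%R by rewrite (Rintegral_gauss s mU).
(* The change of variables is done on compact intervals, whose images under T lie
   in the line, where G is nonnegative. *)
rewrite -EG -Eg; apply: (cvgr_to_le (cvg_Rintegral_sym intg)).
apply: nearW => n.
have nn : - n%:R <= n%:R :> R by rewrite (@le_trans _ _ 0)// lerNl oppr0.
apply: (@le_trans _ _ (\int[mu]_(x in `[- n%:R, n%:R]) w x)%R).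
  apply: le_Rintegral => //.
  - exact: integrableS intg.
  - apply: continuous_compact_integrable; first exact: segment_compact.
    exact: continuous_subspaceT.
have -> : (\int[mu]_(x in `[- n%:R, n%:R]) w x =
           \int[mu]_(x in `[T (- n%:R), T n%:R]) G x)%R.
  rewrite /Rintegral; congr fine.
  have cdT : continuous (fun x => 1 + V' x).
    by move=> x; apply: cvgD; [exact: cvg_cst|exact: cV'].
  rewrite (integration_by_substitution_increasing nn) ?(is_derive1E dT)//.
  - move=> x y _ _ xy; apply: ltr_leD => //.
    by apply: (is_derive_le (ltW xy) (fun z _ => dV z)).
  - exact: (cvgP _ (cvg_at_right_filter (@cdT (- n%:R)))).
  - exact: (cvgP _ (cvg_at_left_filter (@cdT n%:R))).
  - exact: is_derive_LR dT.
  - exact: continuous_subspaceT.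
rewrite /Rintegral fine_le//.
- by apply: integrable_fin_num => //; exact: integrableS intG.
- exact: integrable_fin_num.
- apply: ge0_subset_integral => //.
  + by apply/measurable_EFinP; exact: continuous_measurable_fun.
  + by move=> x _; rewrite lee_fin mulr_ge0 ?normal_pdf_ge0.
Qed.

End one_dimension.

Lemma Rintegral_sum d (T : measurableType d) (R : realType)
    (mu : {measure set T -> \bar R}) (I : Type) (r : seq I) (f : I -> T -> R) :
  (forall i, mu.-integrable setT (EFin \o f i)) ->
  mu.-integrable setT (EFin \o (fun x => \sum_(i <- r) f i x)) /\
  (\int[mu]_x (\sum_(i <- r) f i x) = \sum_(i <- r) \int[mu]_x f i x)%R.
Proof.
move=> fi; elim: r => [|i r [IH1 IH2]].
  rewrite (_ : (fun x => _) = cst 0); last by apply/funext => x; rewrite big_nil.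
  by rewrite big_nil; split; [exact: integrable0|rewrite /Rintegral integral0].
rewrite (_ : (fun x => _) = (fun x => f i x + \sum_(j <- r) f j x)); last first.
  by apply/funext => x; rewrite big_cons.
split; first exact: (integrableD measurableT (fi i) IH1).
by rewrite RintegralD// IH2 big_cons.
Qed.

Lemma continuous_bigsum (R : realType) (I : Type) (r : seq I) (f : I -> R -> R) :
  (forall i, continuous (f i)) -> continuous (fun x => \sum_(i <- r) f i x).
Proof.
move=> cf; elim: r => [|i r IHr].
  rewrite (_ : (fun x => _) = cst 0); last by apply/funext => x; rewrite big_nil.
  exact: cst_continuous.
rewrite (_ : (fun x => _) = (fun x => f i x + \sum_(j <- r) f j x)); last first.
  by apply/funext => x; rewrite big_cons.
by move=> x; apply: cvgD; [exact: cf|exact: IHr].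
Qed.

(** * Gaussian vectors as iterated products *)
Section product_Rintegral.
Context d1 d2 (T1 : measurableType d1) (T2 : measurableType d2) (R : realType).
Variables (P1 : probability T1 R) (P2 : probability T2 R) (f : T1 * T2 -> R).
Hypothesis intf : (P1 \x P2)%E.-integrable setT (EFin \o f).
Hypothesis intf1 : forall x, P2.-integrable setT (EFin \o (fun y => f (x, y))).
Hypothesis intf2 : forall y, P1.-integrable setT (EFin \o (fun x => f (x, y))).

Let F1E : fubini_F P2 (EFin \o f) = EFin \o (fun x => \int[P2]_y f (x, y))%R.
Proof.
apply/funext => x; rewrite /fubini_F /Rintegral /= fineK//.
exact: integrable_fin_num (intf1 x).
Qed.

Let F2E : fubini_G P1 (EFin \o f) = EFin \o (fun y => \int[P1]_x f (x, y))%R.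
Proof.
apply/funext => x; rewrite /fubini_G /Rintegral /= fineK//.
exact: integrable_fin_num (intf2 x).
Qed.

Lemma integrable_Rintegral_section :
  P1.-integrable setT (EFin \o (fun x => \int[P2]_y f (x, y))%R).
Proof. by rewrite -F1E; exact: integrable_fubini_F. Qed.

Lemma Rintegral_prod1 :
  (\int[(P1 \x P2)%E]_z f z = \int[P1]_x \int[P2]_y f (x, y))%R.
Proof.
rewrite /Rintegral; congr fine.
have := integral12_prod_meas1 intf; rewrite F1E => <-.
by [].
Qed.

Lemma Rintegral_prod2 :
  (\int[(P1 \x P2)%E]_z f z = \int[P2]_y \int[P1]_x f (x, y))%R.
Proof.
rewrite /Rintegral; congr fine.
have := integral21_prod_meas1 intf; rewrite F2E => <-.
by [].
Qed.

End product_Rintegral.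

Section gaussian_vectors.
Context {R : realType} (s : R).
Hypothesis s_gt0 : 0 < s.

(** Iterated products carry a varying display, hence the dependent pair. *)
Fixpoint vec_pack (n : nat) : {d : measure_display & measurableType d} :=
  match n with
  | 0 => existT _ _ (unit : measurableType _)
  | n.+1 => existT _ _
      ((measurableTypeR R * projT2 (vec_pack n))%type : measurableType _)
  end.

Definition vec n : measurableType _ := projT2 (vec_pack n).

Fixpoint gaussn n : probability (vec n) R :=
  match n return probability (vec n) R with
  | 0 => \d_tt
  | n.+1 => (gauss s \x gaussn n)%E
  end.

Fixpoint vnth n : vec n -> nat -> R :=
  match n return vec n -> nat -> R with
  | 0 => fun _ _ => 0
  | n.+1 => fun y k => if k is k'.+1 then vnth y.2 k' else y.1
  end.


Definition vsq n (y : vec n) : R := \sum_(k < n) vnth y k ^+ 2.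

Lemma vsqS n (x : R) (y : vec n) : @vsq n.+1 (x, y) = x ^+ 2 + vsq y.
Proof. by rewrite /vsq big_ord_recl. Qed.

Lemma vsq_ge0 n (y : vec n) : 0 <= vsq y.
Proof. by apply: sumr_ge0 => k _; exact: sqr_ge0. Qed.

Lemma measurable_vnth n k : measurable_fun setT (fun y : vec n => vnth y k).
Proof.
elim: n k => [|n IHn] [|k] /=; try exact: measurable_cst.
- exact: measurable_fst.
- exact: (measurableT_comp (IHn k) measurable_snd).
Qed.

(** Membership makes a function integrable for [gaussn], and is inherited by sections
and, up to the type, by partial integrals. *)
Definition vgrowth n (f : vec n -> R) :=
  measurable_fun setT f /\ exists k, forall y, `|f y| <= k * (1 + vsq y).

Lemma vgrowth_section n (f : vec n.+1 -> R) x :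
  vgrowth f -> vgrowth (fun y : vec n => f (x, y)).
Proof.
move=> [mf [k fk]]; split; first exact: measurableT_comp mf (measurable_pair1 x).
have k0 : 0 <= k.
  have := le_trans (normr_ge0 _) (fk (0, point)).
  by rewrite pmulr_lge0//; have := vsq_ge0 ((0, point) : vec n.+1); lra.
exists (k * (1 + x ^+ 2)) => y; apply: le_trans (fk _) _; rewrite vsqS.
have := vsq_ge0 y; have := sqr_ge0 x; rewrite -mulrA => x0 y0.
by rewrite ler_wpM2l//; nra.
Qed.

Lemma vgrowth_vsq n : vgrowth (fun y : vec n => 1 + vsq y).
Proof.
split.
  apply: measurable_funD => //; apply: measurable_sum => k.
  by apply: measurable_funX; exact: measurable_vnth.
by exists 1 => y; rewrite mul1r ger0_norm// addr_ge0 ?vsq_ge0.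
Qed.

Lemma integrable_vsq n : (gaussn n).-integrable setT (EFin \o (fun y => 1 + vsq y)).
Proof.
elim: n => [|n IHn].
  rewrite (_ : EFin \o _ = EFin \o cst 1); first exact: finite_measure_integrable_cst.
  by apply/funext => y; rewrite /vsq /= big_ord0 addr0.
have [mv _] := vgrowth_vsq n.+1.
have mEv : measurable_fun setT (EFin \o (fun y : vec n.+1 => 1 + vsq y)).
  exact/measurable_EFinP.
apply/(@integrable12ltyP _ _ _ _ _ (gauss s) (gaussn n) _ mEv).
pose c := (\int[gaussn n]_y (1 + vsq y))%R.
have E x : (\int[gaussn n]_y `|(1 + @vsq n.+1 (x, y))%:E| = (x ^+ 2 + c)%:E)%E.
  rewrite EFinD /c /Rintegral fineK; last exact: integrable_fin_num.
  rewrite -[X in (X + _)%E](_ : (\int[gaussn n]_y (x ^+ 2)%:E = _)%E); last first.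
    by rewrite integral_cst// [X in (_ * X)%E](probability_setT (gaussn n)) mule1.
  rewrite -integralD//; last exact: finite_measure_integrable_cst.
  apply: eq_integral => y _; rewrite vsqS /= -EFinD addrCA ger0_norm//.
  by rewrite addr_ge0 ?sqr_ge0 ?addr_ge0 ?vsq_ge0.
under eq_integral do rewrite E.
have gx : growth 2 (fun x : R => x ^+ 2 + c).
  apply: growthD; first exact: (growthM growth_id growth_id).
  by do 2 apply: growthS; exact: growth_cst.
have mx : measurable_fun setT (fun x : R => x ^+ 2 + c).
  by apply: measurable_funD => //; exact: measurable_funX.
have /integrableP[_ H] := growth_gauss_integrable s_gt0 mx gx.
apply: le_lt_trans H; apply: ge0_le_integral => //.
- move=> x _; rewrite lee_fin addr_ge0 ?sqr_ge0//.
  by apply: Rintegral_ge0 => y _; rewrite addr_ge0// vsq_ge0.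
- exact/measurable_EFinP.
- by apply: measurableT_comp => //; exact/measurable_EFinP.
- by move=> x _; rewrite lee_fin ler_norm.
Qed.

Lemma vgrowth_integrable n (f : vec n -> R) : vgrowth f ->
  (gaussn n).-integrable setT (EFin \o f).
Proof.
move=> [mf [k fk]]; apply: le_integrable (integrableZl measurableT k (integrable_vsq n)) => //.
  exact/measurable_EFinP.
move=> y _; rewrite lee_fin; apply: le_trans (fk y) _.
exact: ler_norm.
Qed.


Lemma vgrowth_row n (f : vec n.+1 -> R) (y : vec n) : vgrowth f ->
  measurable_fun setT (fun x : R => f (x, y)) /\ growth 2 (fun x => f (x, y)).
Proof.
move=> [mf [k fk]]; split; first exact: measurableT_comp mf (measurable_pair2 y).
have k0 : 0 <= k.
  have := le_trans (normr_ge0 _) (fk (0, point)).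
  by rewrite pmulr_lge0//; have := vsq_ge0 ((0, point) : vec n.+1); lra.
exists (k * (1 + vsq y)) => x; apply: le_trans (fk _) _; rewrite vsqS.
rewrite -mulrA ler_wpM2l// -[x ^+ 2]real_normK ?num_real//.
by have := vsq_ge0 y; have := normr_ge0 x; nra.
Qed.

(** Every section is integrable, not just almost every one, so the iterated integrals
are genuine real integrals at each point. *)
Lemma vgrowth_fubini n (f : vec n.+1 -> R) : vgrowth f ->
  [/\ (\int[gaussn n.+1]_z f z = \int[gauss s]_x \int[gaussn n]_y f (x, y))%R,
      (\int[gaussn n.+1]_z f z = \int[gaussn n]_y \int[gauss s]_x f (x, y))%R,
      measurable_fun setT (fun x : R => \int[gaussn n]_y f (x, y))%R &
      growth 2 (fun x => \int[gaussn n]_y f (x, y))%R].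
Proof.
move=> vf; have iz := vgrowth_integrable vf.
have ix x := vgrowth_integrable (vgrowth_section x vf).
have iy y : (gauss s).-integrable setT (EFin \o (fun x => f (x, y))).
  by have [? ?] := vgrowth_row y vf; exact: growth_gauss_integrable.
have iF := integrable_Rintegral_section iz ix.
split.
- exact: Rintegral_prod1 iz ix.
- exact: Rintegral_prod2 iz iy.
- by apply/measurable_EFinP; exact: measurable_int iF.
- have [mf [k fk]] := vf.
  pose c := (\int[gaussn n]_y (1 + vsq y))%R.
  have c0 : 0 <= c by apply: Rintegral_ge0 => y _; rewrite addr_ge0// vsq_ge0.
  have k0 : 0 <= k.
    have := le_trans (normr_ge0 _) (fk (0, point)).
    by rewrite pmulr_lge0//; have := vsq_ge0 ((0, point) : vec n.+1); lra.
  have i1 := finite_measure_integrable_cst (gaussn n) (_ : R) measurableT.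
  exists (k * (1 + c)) => x.
  apply: le_trans (le_normr_Rintegral measurableT (ix x)) _.
  apply: (@le_trans _ _ (\int[gaussn n]_y (k * (x ^+ 2 + (1 + vsq y))))%R).
    apply: le_Rintegral => //.
    - exact: integrable_norm.
    - exact: (integrableZl measurableT k (integrableD measurableT (i1 _) (integrable_vsq n))).
    - by move=> y _; apply: le_trans (fk _) _; rewrite vsqS addrCA.
  rewrite RintegralZl//; last exact: (integrableD measurableT (i1 _) (integrable_vsq n)).
  rewrite RintegralD//; [|exact: i1|exact: integrable_vsq].
  rewrite Rintegral_prob_cst -mulrA ler_wpM2l// -[x ^+ 2]real_normK ?num_real//.
  by rewrite -/c; have := normr_ge0 x; nra.
Qed.

End gaussian_vectors.

(** * The variance inequality in several dimensions *)
Section several_dimensions.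
Context {R : realType} (s : R).
Hypothesis s_gt0 : 0 < s.
Context {S : finType} (t : R).
Implicit Types (W : S -> R) (e : nat -> S -> R).

Definition energy n e (y : vec n) (a : S) : R := \sum_(k < n) vnth y k * e k a.

Lemma energyS n e (x : R) (y : vec n) a :
  energy e ((x, y) : vec n.+1) a = x * e 0 a + energy (fun k => e k.+1) y a.
Proof. by rewrite /energy big_ord_recl. Qed.

Definition weight n W e (y : vec n) (a : S) : R := W a * expR (t * energy e y a).

(** Fixing the first coordinate of the field only changes the weights of the
configurations; the recursions on the dimension below generalize over [W] and [e]
for this reason. *)
Definition freeze W e (x : R) (a : S) : R := W a * expR (t * (x * e 0%N a)).

Lemma weightS n W e (x : R) (y : vec n) a :
  weight W e ((x, y) : vec n.+1) a = weight (freeze W e x) (fun k => e k.+1) y a.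
Proof. by rewrite /weight /freeze energyS mulrDr expRD mulrA. Qed.

(** [D] is a gradient of [m]. Each coordinate is constrained only along its own
axis, which is what the one-dimensional inequality asks of the average of [m] over
the later coordinates. *)
Fixpoint regular (L : R) n : (vec n -> R) -> (nat -> vec n -> R) -> Prop :=
  match n return (vec n -> R) -> (nat -> vec n -> R) -> Prop with
  | 0 => fun _ _ => True
  | n.+1 => fun m D =>
    [/\ measurable_fun setT m /\ vgrowth (fun y => m y ^+ 2),
        measurable_fun setT (D 0%N) /\ (forall y, `|D 0%N y| <= L),
        exists K, forall x x' y,
          `|D 0%N (x, y) - D 0%N (x', y)| <= K * `|x - x'|,
        forall x x' y, m (x, y) + D 0%N (x, y) * (x' - x) <= m (x', y) &
        forall x, regular L (fun y => m (x, y)) (fun k y => D k.+1 (x, y))]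
  end.

(** From [`|m| <= m ^+ 2 + 1]. *)
Lemma vgrowth_sqr n (m : vec n -> R) : measurable_fun setT m ->
  vgrowth (fun y => m y ^+ 2) -> vgrowth m.
Proof.
move=> mm [_ [k mk]]; split => //; exists (k + 1) => y.
rewrite mulrDl mul1r (@le_trans _ _ (m y ^+ 2 + 1))//; last first.
  by rewrite lerD ?(le_trans (ler_norm _) (mk y))// lerDl vsq_ge0.
by rewrite -[m y ^+ 2]real_normK ?num_real//; have := sqr_ge0 (`|m y| - 1); nra.
Qed.

Lemma vgrowth_bounded n (f : vec n -> R) k : measurable_fun setT f ->
  (forall y, `|f y| <= k) -> vgrowth f.
Proof.
move=> mf fk; split => //; exists k => y; apply: le_trans (fk y) _.
rewrite ler_peMr ?lerDl ?vsq_ge0//.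
exact: le_trans (normr_ge0 _) (fk point).
Qed.

Lemma vgrowthD n (f g : vec n -> R) : vgrowth f -> vgrowth g ->
  vgrowth (fun y => f y + g y).
Proof.
move=> [mf [k fk]] [mg [l gl]]; split; first exact: measurable_funD.
by exists (k + l) => y; rewrite mulrDl (le_trans (ler_normD _ _))// lerD.
Qed.

Lemma Rintegral_vec0 (f : vec 0 -> R) : (\int[gaussn s 0]_y f y = f tt)%R.
Proof.
have mf : measurable_fun setT (fun y : vec 0 => (f y)%:E) by [].
by rewrite /Rintegral integral_dirac// diracE mem_set// mul1e.
Qed.

(** With the first coordinates of [y] and [y'] frozen at [x] and [z], the induction
hypothesis applies with [C y + D 0 y * (z - x)] in place of [C]. Its conclusion is the
hypothesis of [gauss_variance_le] for the partial averages [m1], [b1] of [m], [D 0],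
with [C1] containing half the conditional variance of [m]. The two variances
add up by the law of total variance. *)
Lemma vec_variance_le W e n m (C : vec n -> R) D L : (forall a, 0 <= W a) ->
  (forall k a, e k a ^+ 2 = 1) ->
  regular L m D -> vgrowth C ->
  (forall y y' : vec n, expR (m y + C y + \sum_(k < n) D k y * (vnth y' k - vnth y k))
     <= \sum_a weight W e y' a) ->
  expR ((\int[gaussn s n]_y m y) + (\int[gaussn s n]_y C y) +
    ((\int[gaussn s n]_y (m y ^+ 2)) - (\int[gaussn s n]_y m y) ^+ 2) / 2)%R
  <= expR (n%:R * (t ^+ 2 * s ^+ 2 / 2)) * \sum_a W a.
Proof.
elim: n W e m C D => [|n IHn] W e m C D W0 e1 mD vC H.
  rewrite !Rintegral_vec0 mul0r expR0 mul1r subrr mul0r addr0.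
  have := H tt tt; rewrite big_ord0 addr0 => /le_trans; apply.
  rewrite le_eqVlt; apply/orP; left; apply/eqP; apply: eq_bigr => a _.
  by rewrite /weight /energy big_ord0 mulr0 expR0 mulr1.
have [[mm vm2] [mD0 D0L] [K DK] cvx mDx] := mD.
have vm := vgrowth_sqr mm vm2.
have vD0 := vgrowth_bounded mD0 D0L.
have [E1m _ mE gE] := vgrowth_fubini s_gt0 vm.
have [E1m2 _ mE2 gE2] := vgrowth_fubini s_gt0 vm2.
have [E1C _ mEC gEC] := vgrowth_fubini s_gt0 vC.
have [_ _ mED gED] := vgrowth_fubini s_gt0 vD0.
have im x := vgrowth_integrable s_gt0 (vgrowth_section x vm).
have im2 x := vgrowth_integrable s_gt0 (vgrowth_section x vm2).
have iC x := vgrowth_integrable s_gt0 (vgrowth_section x vC).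
have iD x := vgrowth_integrable s_gt0 (vgrowth_section x vD0).
pose m1 x := (\int[gaussn s n]_y m (x, y))%R.
pose m2 x := (\int[gaussn s n]_y (m (x, y) ^+ 2))%R.
pose C0 x := (\int[gaussn s n]_y C (x, y))%R.
pose b1 x := (\int[gaussn s n]_y D 0 (x, y))%R.
pose C1 x := C0 x + (m2 x - m1 x ^+ 2) / 2.
pose q := t ^+ 2 * s ^+ 2 / 2.
pose U z := expR (n%:R * q) * \sum_a freeze W e z a.
have m1cvx x z : m1 x + b1 x * (z - x) <= m1 z.
  rewrite /m1 /b1 -RintegralZr// -RintegralD//; last first.
    exact: (integrableZr measurableT (z - x) (iD x)).
  apply: le_Rintegral => //.
    exact: (integrableD measurableT (im x) (integrableZr measurableT (z - x) (iD x))).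
have b1L x : `|b1 x| <= L.
  apply: le_trans (le_normr_Rintegral measurableT (iD x)) _.
  rewrite -[leRHS](Rintegral_prob_cst (gaussn s n)).
  apply: le_Rintegral => //; first exact: integrable_norm.
  exact: finite_measure_integrable_cst.
have cb1 : continuous b1.
  have K0 x z : `|b1 x - b1 z| <= K * `|x - z|.
    rewrite /b1 -RintegralB//.
    have iDD := integrableB measurableT (iD x) (iD z).
    apply: le_trans (le_normr_Rintegral measurableT iDD) _.
    rewrite -[leRHS](Rintegral_prob_cst (gaussn s n)).
    apply: le_Rintegral => //; first exact: integrable_norm.
    exact: finite_measure_integrable_cst.
  move=> x; apply/cvgrPdist_le => eps eps0; near=> z.
  apply: le_trans (K0 x z) _.
  have : `|x - z| <= eps / (`|K| + 1).
    near: z; apply: cvgr_dist_le; first exact: cvg_id.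
    by rewrite divr_gt0// ltr_wpDl.
  rewrite ler_pdivlMr ?ltr_wpDl// => /(le_trans _); apply.
  rewrite mulrC ler_wpM2l// (le_trans (ler_norm _))// lerDl//.
have gm1 := growth_subgradient m1cvx b1L cb1.
have mm1 : measurable_fun setT m1 by [].
have im1 := growth_gauss_integrable s_gt0 mm1 gE.
have mm12 : measurable_fun setT (fun x => m1 x ^+ 2) by exact: measurable_funX.
have gm12 : growth 2 (fun x => m1 x ^+ 2) by exact: (growthM gm1 gm1).
have im12 := growth_gauss_integrable s_gt0 mm12 gm12.
have imE2 := growth_gauss_integrable s_gt0 mE2 gE2.
have iEC := growth_gauss_integrable s_gt0 mEC gEC.
have gV : growth 2 (fun x => (m2 x - m1 x ^+ 2) / 2).
  exact: (growthM (growthB gE2 gm12) (growth_cst 2^-1)).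
have gC1 : growth 2 C1 by exact: growthD.
have mC1 : measurable_fun setT C1.
  apply: measurable_funD => //; apply: measurable_funM => //.
  exact: measurable_funB.
have HU x z : expR (m1 x + C1 x + b1 x * (z - x)) <= U z.
  have W0z a : 0 <= freeze W e z a by rewrite mulr_ge0 ?expR_ge0.
  have vCx : vgrowth (fun y : vec n => C (x, y) + D 0 (x, y) * (z - x)).
    apply: vgrowthD; first exact: vgrowth_section.
    apply: (vgrowth_bounded (k := L * `|z - x|)).
      by apply: measurable_funM => //; have [] := vgrowth_section x vD0.
    by move=> y; rewrite normrM ler_wpM2r.
  have := IHn _ (fun k => e k.+1) _ _ _ W0z (fun k => e1 k.+1) (mDx x) vCx.
  move=> /(_ _)/wrap[].
    move=> y y'; have := H (x, y) (z, y'); rewrite big_ord_recl !addrA.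
    by rewrite (eq_bigr _ (fun a _ => weightS W e z y' a)).
  rewrite -/q -/(U z); apply: le_trans; rewrite ler_expR.
  rewrite RintegralD//; last exact: (integrableZr measurableT (z - x) (iD x)).
  rewrite RintegralZr// -/(m1 x) -/(m2 x) -/(C0 x) -/(b1 x) /C1.
  by rewrite le_eqVlt; apply/orP; left; apply/eqP; ring.
have U0 z : 0 <= U z.
  by rewrite mulr_ge0 ?expR_ge0// sumr_ge0// => a _; rewrite mulr_ge0 ?expR_ge0.
have EexpR a : (gauss s).-integrable setT (EFin \o (fun z : R => expR ((t * e 0%N a) * z))) /\
    (\int[gauss s]_z expR ((t * e 0%N a) * z) = expR q)%R.
  have EE := integral_gauss_expR s_gt0 (t * e 0%N a).
  rewrite exprMn e1 mulr1 -/q in EE; split; last by rewrite /Rintegral EE.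
  apply/integrableP; split.
    apply/measurable_EFinP; apply: measurableT_comp; first exact: measurable_expR.
    exact: measurable_funM.
  by under eq_integral do rewrite /= ger0_norm ?expR_ge0//; rewrite EE ltry.
have UE : U = fun z => \sum_a (expR (n%:R * q) * W a) * expR ((t * e 0%N a) * z).
  apply/funext => z; rewrite /U mulr_sumr; apply: eq_bigr => a _.
  by rewrite /freeze mulrA; congr (_ * expR _); ring.
have [intU EU] : (gauss s).-integrable setT (EFin \o U) /\
    (\int[gauss s]_z U z = expR (n.+1%:R * q) * \sum_a W a)%R.
  have iU a := integrableZl measurableT (expR (n%:R * q) * W a) (EexpR a).1.
  rewrite UE; have [? ->] := Rintegral_sum (index_enum S) iU; split => //.
  rewrite mulr_sumr; apply: eq_bigr => a _.
  have [ia Ea] := EexpR a; rewrite RintegralZl// Ea mulrAC -expRD.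
  by congr (expR _ * _); rewrite -natr1 mulrDl mul1r.
have cU : continuous U.
  rewrite UE; apply: continuous_bigsum => a z; apply: cvgMr.
  apply: (@cvg_comp _ _ _ (fun z => (t * e 0%N a) * z) expR).
    by apply: cvgMr; exact: cvg_id.
  exact: continuous_expR.
have := gauss_variance_le s_gt0 m1cvx b1L cb1 mC1 gC1 cU U0 intU HU.
rewrite EU; apply: le_trans; rewrite ler_expR E1m E1m2 E1C.
have iV := growth_gauss_integrable s_gt0 (measurable_funB mE2 mm12) (growthB gE2 gm12).
have -> : (\int[gauss s]_x C1 x = \int[gauss s]_x C0 x +
    ((\int[gauss s]_x m2 x) - \int[gauss s]_x (m1 x ^+ 2)) / 2)%R.
  rewrite /C1 RintegralD//; last exact: (integrableZr measurableT 2^-1 iV).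
  by rewrite RintegralZr// RintegralB.
rewrite -/m1 -/m2 -/C0 le_eqVlt; apply/orP; left; apply/eqP.
by field.
Unshelve. all: by end_near. Qed.

End several_dimensions.

(** * Gibbs averages over a finite set *)
Section gibbs.
Context {R : realType} {S : finType}.

Definition gibbs (w : S -> R) (f : S -> R) : R := (\sum_a f a * w a) / \sum_a w a.

Lemma sum_gt0 (w : S -> R) : inhabited S -> (forall a, 0 < w a) -> 0 < \sum_a w a.
Proof.
move=> [a0] w0; rewrite (bigD1 a0)//= ltr_pwDl// sumr_ge0// => a _.
exact: ltW.
Qed.

Section positive_weights.
Variable w : S -> R.
Hypotheses (S0 : inhabited S) (w0 : forall a, 0 < w a).

Let Z_gt0 : 0 < \sum_a w a. Proof. exact: sum_gt0. Qed.

Let Z_neq0 : \sum_a w a != 0. Proof. by rewrite gt_eqF. Qed.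

Lemma gibbs_cst c : gibbs w (fun=> c) = c.
Proof. by rewrite /gibbs -mulr_sumr mulfK. Qed.

Lemma gibbsD f g : gibbs w (fun a => f a + g a) = gibbs w f + gibbs w g.
Proof.
rewrite /gibbs -mulrDl -big_split/=; congr (_ / _).
by apply: eq_bigr => a _; rewrite mulrDl.
Qed.

Lemma gibbsZ c f : gibbs w (fun a => c * f a) = c * gibbs w f.
Proof.
rewrite /gibbs mulrA mulr_sumr; congr (_ / _).
by apply: eq_bigr => a _; rewrite mulrA.
Qed.

Lemma gibbs_sum n (f : 'I_n -> S -> R) :
  gibbs w (fun a => \sum_(k < n) f k a) = \sum_(k < n) gibbs w (f k).
Proof.
rewrite /gibbs -mulr_suml exchange_big/=; congr (_ / _).
by apply: eq_bigr => a _; rewrite mulr_suml.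
Qed.

Lemma gibbs_le f g : (forall a, f a <= g a) -> gibbs w f <= gibbs w g.
Proof.
move=> fg; rewrite ler_pM2r ?invr_gt0//; apply: ler_sum => a _.
by rewrite ler_wpM2r// ltW.
Qed.

Lemma gibbs_norm f c : (forall a, `|f a| <= c) -> `|gibbs w f| <= c.
Proof.
move=> fc; rewrite ler_norml -[- c]gibbs_cst -[c in X in _ && X]gibbs_cst.
by apply/andP; split; apply: gibbs_le => a; have := fc a; rewrite ler_norml => /andP[].
Qed.

(** The tangent of the exponential at [gibbs w f]. *)
Lemma gibbs_jensen f :
  (\sum_a w a) * expR (gibbs w f) <= \sum_a w a * expR (f a).
Proof.
set c := gibbs w f.
have H : gibbs w (fun a => expR c * (1 + (f a - c))) <= gibbs w (fun a => expR (f a)).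
  apply: gibbs_le => a; rewrite -{2}[f a](subrK c) [leRHS]expRD mulrC.
  by rewrite ler_wpM2r ?expR_ge0// expR_ge1Dx.
move: H; rewrite gibbsZ 2!gibbsD !gibbs_cst -/c subrr addr0 mulr1.
rewrite ler_pdivlMr// mulrC; congr (_ <= _).
by apply: eq_bigr => a _; rewrite mulrC.
Qed.

Lemma ln_gibbs_jensen f :
  ln (\sum_a w a) + gibbs w f <= ln (\sum_a w a * expR (f a)).
Proof.
rewrite -[X in _ + X]expRK -lnM ?posrE ?expR_gt0// ler_ln ?posrE.
- exact: gibbs_jensen.
- by rewrite mulr_gt0 ?expR_gt0.
- by apply: sum_gt0 => // a; rewrite mulr_gt0 ?expR_gt0.
Qed.

End positive_weights.

Lemma is_derive_bigsum (I : Type) (r : seq I) (F : I -> R -> R) (f : I -> R) (x : R) :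
  (forall i, is_derive x 1 (F i) (f i)) ->
  is_derive x 1 (fun y => \sum_(i <- r) F i y) (\sum_(i <- r) f i).
Proof.
move=> dF; elim: r => [|i r IHr].
  rewrite (_ : (fun x => _) = cst 0); last by apply/funext => y; rewrite big_nil.
  by rewrite big_nil; exact: is_derive_cst.
rewrite (_ : (fun x => _) = (fun x => F i x + \sum_(j <- r) F j x)); last first.
  by apply/funext => y; rewrite big_cons.
by rewrite big_cons; exact: is_deriveD.
Qed.

(** As [eps] takes the values [1] and [-1], numerator and denominator of the average
are, up to the factor [t], derivatives of each other. *)
Lemma is_derive_gibbs_sign (w eps : S -> R) (t : R) : inhabited S ->
  (forall a, 0 < w a) -> (forall a, eps a ^+ 2 = 1) ->
  forall x : R,
  is_derive x 1 (fun x => gibbs (fun a => w a * expR (t * (x * eps a))) eps)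
    (t * (1 - gibbs (fun a => w a * expR (t * (x * eps a))) eps ^+ 2)).
Proof.
move=> S0 w0 eps2 x.
pose Z (x : R) := \sum_a w a * expR (t * (x * eps a)).
pose M (x : R) := \sum_a eps a * (w a * expR (t * (x * eps a))).
have Z0 y : 0 < Z y by apply: sum_gt0 => // a; rewrite mulr_gt0 ?expR_gt0.
have dexp a : is_derive x 1 (fun x => w a * expR (t * (x * eps a)))
   (t * (eps a * (w a * expR (t * (x * eps a))))).
  have d1 := is_derive_mul (is_derive_cst t x 1)
    (is_derive_mul (is_derive_id x 1) (is_derive_cst (eps a) x 1)).
  apply: is_derive_eq (is_derive_mul (is_derive_cst (w a) x 1) (is_derive_expR_comp d1)) _.
  by rewrite /=; ring.
have dZ : is_derive x 1 Z (t * M x).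
  by rewrite /M mulr_sumr; exact: is_derive_bigsum.
have dM : is_derive x 1 M (t * Z x).
  rewrite /Z mulr_sumr; apply: is_derive_bigsum => a.
  apply: is_derive_eq (is_derive_mul (is_derive_cst (eps a) x 1) (dexp a)) _.
  by rewrite /= -[RHS]mul1r -(eps2 a); ring.
have Zx : Z x != 0 by rewrite gt_eqF.
apply: is_derive_eq (is_derive_mul dM (is_deriveV Zx dZ)) _.
rewrite /gibbs -/(M x) -/(Z x) -[_ *: _]/(_ * _).
by field.
Qed.

End gibbs.

(** * Gibbs averages in Gaussian fields *)
Section gibbs_vec.
Context {R : realType} (s : R).
Hypothesis s_gt0 : 0 < s.
Context {S : finType}.
Hypothesis S0 : inhabited S.
Implicit Types (W : S -> R) (e : nat -> S -> R).

Lemma weight_gt0 t n W e (y : vec n) a : (forall a, 0 < W a) ->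
  0 < weight t W e y a.
Proof. by move=> W0; rewrite mulr_gt0 ?expR_gt0. Qed.

Lemma freeze_gt0 t W e (x : R) a : (forall a, 0 < W a) -> 0 < freeze t W e x a.
Proof. by move=> W0; rewrite mulr_gt0 ?expR_gt0. Qed.

Lemma gibbsS t n W e (x : R) (y : vec n) f :
  gibbs (weight t W e ((x, y) : vec n.+1)) f =
  gibbs (weight t (freeze t W e x) (fun k => e k.+1) y) f.
Proof. by congr (gibbs _ f); apply/funext => a; rewrite weightS. Qed.

Lemma measurable_weight t n W e a :
  measurable_fun setT (fun y : vec n => weight t W e y a).
Proof.
apply: measurable_funM => //; apply: measurableT_comp; first exact: measurable_expR.
apply: measurable_funM => //; apply: measurable_sum => k.
by apply: measurable_funM => //; exact: measurable_vnth.
Qed.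

Lemma measurable_lnZ t n W e :
  measurable_fun setT (fun y : vec n => ln (\sum_a weight t W e y a)).
Proof.
apply: measurableT_comp; first exact: measurable_ln.
by apply: measurable_sum => a; exact: measurable_weight.
Qed.

Lemma measurable_gibbs t n W e f : (forall a, 0 < W a) ->
  measurable_fun setT (fun y : vec n => gibbs (weight t W e y) f).
Proof.
move=> W0; rewrite (_ : (fun y => _) = (fun y : vec n =>
    (\sum_a f a * weight t W e y a) * expR (- ln (\sum_a weight t W e y a)))).
  apply: measurable_funM.
    apply: measurable_sum => a; apply: measurable_funM => //.
    exact: measurable_weight.
  apply: measurableT_comp; first exact: measurable_expR.
  by apply: measurableT_comp => //; exact: measurable_lnZ.
apply/funext => y; rewrite expRN lnK// posrE.
by apply: sum_gt0 => // a; exact: weight_gt0.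
Qed.

Lemma abs_le1 (x : R) : x ^+ 2 = 1 -> `|x| <= 1.
Proof.
move=> x2; rewrite -(@ler_pXn2r _ 2)// ?nnegrE// expr1n.
by rewrite real_normK ?num_real// x2.
Qed.

Lemma gibbs_sign_le1 t n W e (y : vec n) k : (forall a, 0 < W a) ->
  (forall k a, e k a ^+ 2 = 1) -> `|gibbs (weight t W e y) (e k)| <= 1.
Proof.
move=> W0 e1; apply: gibbs_norm => // a; first exact: weight_gt0.
exact: abs_le1.
Qed.

(** Convexity of the free energy in the field, from Jensen's inequality for the
Gibbs measure at [y]. *)
Lemma free_energy_subgradient t n W e (y y' : vec n) : (forall a, 0 < W a) ->
  ln (\sum_a weight t W e y a) +
   \sum_(k < n) t * gibbs (weight t W e y) (e k) * (vnth y' k - vnth y k)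
  <= ln (\sum_a weight t W e y' a).
Proof.
move=> W0; have w0 a := weight_gt0 t e y a W0.
have := ln_gibbs_jensen S0 w0 (fun a => \sum_(k < n) (t * (vnth y' k - vnth y k)) * e k a).
rewrite gibbs_sum (eq_bigr (fun k : 'I_n =>
    t * gibbs (weight t W e y) (e k) * (vnth y' k - vnth y k))); last first.
  by move=> k _; rewrite gibbsZ mulrAC.
rewrite (_ : \sum_a _ * expR _ = \sum_a weight t W e y' a)//.
apply: eq_bigr => a _; rewrite /weight -mulrA -expRD; congr (_ * expR _).
rewrite /energy !mulr_sumr -big_split/=; apply: eq_bigr => k _.
by ring.
Qed.

Fixpoint vzero n : @vec R n :=
  match n return @vec R n with 0 => tt | n.+1 => (0, vzero n) end.

Lemma vnth_vzero n k : vnth (vzero n) k = 0 :> R.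
Proof. by elim: n k => [|n IHn] [|k] //=. Qed.

Lemma sqr_sum_le n (a : 'I_n -> R) :
  (\sum_(k < n) a k) ^+ 2 <= 2 ^+ n * \sum_(k < n) a k ^+ 2.
Proof.
elim: n a => [|n IHn] a; first by rewrite !big_ord0 expr0n mulr0.
rewrite !big_ord_recl (exprS 2 n); have := IHn (fun k => a (lift ord0 k)).
set x := a ord0; set p := \sum_(i < n) _; set q := \sum_(i < n) _.
have two1 : 1 <= 2 ^+ n :> R by rewrite exprn_ege1// ler1n.
have := sqr_ge0 (x - p); have : 0 <= (2 ^+ n - 1) * x ^+ 2.
  by rewrite mulr_ge0 ?subr_ge0 ?sqr_ge0.
by move=> h1 h2 h3; nra.
Qed.

Lemma lnZ_growth t n W e : (forall a, 0 < W a) -> (forall k a, e k a ^+ 2 = 1) ->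
  vgrowth (fun y : vec n => ln (\sum_a weight t W e y a) ^+ 2).
Proof.
move=> W0 e1; split; first by apply: measurable_funX; exact: measurable_lnZ.
pose F (y : vec n) := ln (\sum_a weight t W e y a).
pose N (y : @vec R n) : R := \sum_(k < n) `|vnth y k|.
have slope (y y' : vec n) : F y - `|t| * \sum_(k < n) `|vnth y' k - vnth y k| <= F y'.
  apply: le_trans (free_energy_subgradient t e y y' W0); rewrite lerD2l.
  rewrite mulr_sumr -sumrN; apply: ler_sum => k _; rewrite lerNl.
  rewrite (le_trans (ler_norm _))// normrN 2!normrM ler_wpM2r// ler_piMr//.
  exact: gibbs_sign_le1.
have F_le y : `|F y| <= `|F (vzero n)| + `|t| * N y.
  have H1 := slope y (vzero n); have H2 := slope (vzero n) y.
  have E1 : \sum_(k < n) `|vnth (vzero n) k - vnth y k| = N y.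
    by apply: eq_bigr => k _; rewrite vnth_vzero sub0r normrN.
  have E2 : \sum_(k < n) `|vnth y k - vnth (vzero n) k| = N y.
    by apply: eq_bigr => k _; rewrite vnth_vzero subr0.
  rewrite E1 in H1; rewrite E2 in H2.
  have := ler_norm (F (vzero n)); have := ler_norm (- F (vzero n)); rewrite normrN.
  by rewrite ler_norml => *; apply/andP; split; lra.
have N_le y : N y ^+ 2 <= 2 ^+ n * vsq y.
  apply: le_trans (sqr_sum_le _) _; rewrite ler_wpM2l ?exprn_ge0//.
  by apply: ler_sum => k _; rewrite real_normK ?num_real.
set c := `|F (vzero n)| in F_le.
exists (2 * c ^+ 2 + 2 * t ^+ 2 * 2 ^+ n) => y.
rewrite -/(F y) normrX.
have H : `|F y| ^+ 2 <= (c + `|t| * N y) ^+ 2 by rewrite ler_pXn2r ?nnegrE// (le_trans _ (F_le y)).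
apply: le_trans H _.
have H2 : (c + `|t| * N y) ^+ 2 <= 2 * c ^+ 2 + 2 * (t ^+ 2 * N y ^+ 2).
  rewrite -[t ^+ 2]real_normK ?num_real// -exprMn.
  by have := sqr_ge0 (c - `|t| * N y); nra.
apply: le_trans H2 _.
have t2 := sqr_ge0 t; have c2 := sqr_ge0 c; have v0 := vsq_ge0 y.
have p0 : 0 <= 2 ^+ n :> R by rewrite exprn_ge0.
have H3 : t ^+ 2 * N y ^+ 2 <= t ^+ 2 * (2 ^+ n * vsq y) by rewrite ler_wpM2l.
have H4 : 0 <= t ^+ 2 * 2 ^+ n by rewrite mulr_ge0.
nra.
Qed.

(** The gradient of the free energy is [t] times the Gibbs average of the signs, hence
bounded by [`|t|] and Lipschitz by [is_derive_gibbs_sign]. *)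
Lemma lnZ_regular t n W e : (forall a, 0 < W a) -> (forall k a, e k a ^+ 2 = 1) ->
  regular `|t| (fun y : vec n => ln (\sum_a weight t W e y a))
    (fun k y => t * gibbs (weight t W e y) (e k)).
Proof.
elim: n W e => [//|n IHn] W e W0 e1; split.
- by split; [exact: measurable_lnZ|exact: lnZ_growth].
- split; first by apply: measurable_funM => //; exact: measurable_gibbs.
  by move=> y; rewrite normrM ler_piMr// gibbs_sign_le1.
- exists (t ^+ 2) => x x' y.
  pose w a := weight t W (fun k => e k.+1) y a.
  have E z : gibbs (weight t W e ((z, y) : vec n.+1)) (e 0%N) =
      gibbs (fun a => w a * expR (t * (z * e 0%N a))) (e 0%N).
    congr (gibbs _ _); apply/funext => a.
    by rewrite weightS /weight /freeze /w /weight mulrAC.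
  rewrite -mulrBr normrM !E distrC.
  have w0 a : 0 < w a by exact: weight_gt0.
  pose A z := gibbs (fun a => w a * expR (t * (z * e 0%N a))) (e 0%N).
  have A1 z : `|A z| <= 1 by rewrite /A -E gibbs_sign_le1.
  have := is_derive_lipschitz x x' (is_derive_gibbs_sign t S0 w0 (e1 0%N)) (k := `|t|) _.
  rewrite -/(A x) -/(A x') => /(_ _)/wrap[].
    move=> z; rewrite -/(A z) normrM ler_piMr//.
    have := A1 z; have := normr_ge0 (A z); rewrite -[A z ^+ 2]real_normK ?num_real// => a0 a1.
    by rewrite ger0_norm; nra.
  move=> H; rewrite -[t ^+ 2]real_normK ?num_real// expr2 -mulrA ler_wpM2l//.
  by rewrite [`|x - _|]distrC.
- move=> x x' y.
  have := free_energy_subgradient t e ((x, y) : vec n.+1) ((x', y) : vec n.+1) W0.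
  rewrite big_ord_recl [X in _ + (_ + X) <= _]big1 ?addr0// => k _.
  by rewrite /= subrr mulr0.
- move=> x; have := IHn (freeze t W e x) (fun k => e k.+1)
    (fun a => freeze_gt0 t e x a W0) (fun k => e1 k.+1).
  rewrite (_ : (fun y => ln _) =
      (fun y : vec n => ln (\sum_a weight t W e ((x, y) : vec n.+1) a))); last first.
    by apply/funext => y; congr ln; apply: eq_bigr => a _; rewrite weightS.
  rewrite (_ : (fun k y => t * _) = (fun k (y : vec n) =>
      t * gibbs (weight t W e ((x, y) : vec n.+1)) (e k.+1))) //.
  apply/funext => k; apply/funext => y; congr (t * _).
  exact: (esym (gibbsS t W e x y (e k.+1))).
Qed.

Lemma variance_lnZ_le t n W e : (forall a, 0 < W a) -> (forall k a, e k a ^+ 2 = 1) ->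
  (\int[gaussn s n]_y ln (\sum_a weight t W e y a) +
   ((\int[gaussn s n]_y (ln (\sum_a weight t W e y a) ^+ 2)) -
    (\int[gaussn s n]_y ln (\sum_a weight t W e y a)) ^+ 2) / 2)%R
  <= n%:R * (t ^+ 2 * s ^+ 2 / 2) + ln (\sum_a W a).
Proof.
move=> W0 e1; have Z0 : 0 < \sum_a W a by exact: sum_gt0.
have vC : vgrowth (fun y : vec n => 0 : R).
  by apply: (@vgrowth_bounded _ _ _ 0) => // y; rewrite normr0.
have H (y y' : vec n) : expR (ln (\sum_a weight t W e y a) + 0 +
      \sum_(k < n) t * gibbs (weight t W e y) (e k) * (vnth y' k - vnth y k))
    <= \sum_a weight t W e y' a.
  have Zy : 0 < \sum_a weight t W e y' a by apply: sum_gt0 => // a; exact: weight_gt0.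
  rewrite addr0 -[leRHS]lnK// ler_expR; exact: free_energy_subgradient.
have := vec_variance_le s_gt0 (fun a => ltW (W0 a)) e1 (lnZ_regular t n W0 e1) vC H.
rewrite Rintegral_prob_cst addr0 -[X in _ <= _ * X]lnK// -expRD ler_expR.
by [].
Qed.

Lemma gibbs_weight0 t n W e (x : R) (y : vec n) f :
  gibbs (weight t W e ((x, y) : vec n.+1)) f =
  gibbs (fun a => weight t W (fun k => e k.+1) y a * expR (t * (x * e 0%N a))) f.
Proof.
congr (gibbs _ _); apply/funext => a.
by rewrite weightS /weight /freeze /weight mulrAC.
Qed.

Lemma gibbs_sign_ibp t (w eps : S -> R) : (forall a, 0 < w a) ->
  (forall a, eps a ^+ 2 = 1) ->
  let A x := gibbs (fun a => w a * expR (t * (x * eps a))) eps in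
  (\int[gauss s]_x (x * A x) = \int[gauss s]_x (t * s ^+ 2 * (1 - A x ^+ 2)))%R.
Proof.
move=> w0 eps1 A; have dA := is_derive_gibbs_sign t S0 w0 eps1.
have cA : continuous A := is_derive_cont dA.
have A0 : growth 0 A.
  exists 1 => x; rewrite mulr1; apply: gibbs_norm => // a; last exact: abs_le1.
  by rewrite mulr_gt0 ?expR_gt0.
pose f x := t * (1 - A x ^+ 2).
have cf : continuous f.
  move=> x; apply: cvgMr; apply: cvgB (cvg_cst _) _.
  by apply: cvgM; exact: cA.
have f0 : growth 0 f.
  by apply: growthZ; apply: growthB (growth_cst 1) (growthM A0 A0).
have xA1 : growth 1 (fun x => x * A x) by exact: (growthM growth_id A0).
have xAs : growth 2 (fun x => x * A x / s ^+ 2).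
  by apply: growthS; exact: (growthM xA1 (growth_cst (s ^+ 2)^-1)).
have f2 : growth 2 f by apply: growthS; exact: growthS.
have := gauss_derive0_growth s_gt0 dA cf (growthS (growthS A0)) (growthB f2 xAs).
have mf : measurable_fun setT f by exact: continuous_measurable_fun.
have mxA : measurable_fun setT (fun x : R => x * A x).
  by apply: continuous_measurable_fun => x; apply: cvgM; [exact: cvg_id|exact: cA].
have i1 := growth_gauss_integrable s_gt0 mf f2.
have i2 := growth_gauss_integrable s_gt0 mxA (growthS xA1).
rewrite RintegralB//; last exact: (integrableZr measurableT (s ^+ 2)^-1 i2).
rewrite RintegralZr// => /eqP; rewrite subr_eq0 => /eqP H.
have v0 : s ^+ 2 != 0 by rewrite gt_eqF// exprn_gt0.
have -> : (fun x => t * s ^+ 2 * (1 - A x ^+ 2)) = (fun x => s ^+ 2 * f x).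
  by apply/funext => x; rewrite /f; ring.
by rewrite RintegralZl// H mulrC divfK.
Qed.

Lemma vgrowth_gibbs_sqr t n W e k : (forall a, 0 < W a) ->
  (forall k a, e k a ^+ 2 = 1) ->
  vgrowth (fun y : vec n => t * s ^+ 2 * (1 - gibbs (weight t W e y) (e k) ^+ 2)).
Proof.
move=> W0 e1; apply: (@vgrowth_bounded _ _ _ `|t * s ^+ 2|).
  apply: measurable_funM => //; apply: measurable_funB => //.
  by apply: measurable_funX; exact: measurable_gibbs.
move=> y; rewrite normrM ler_piMr//.
have := gibbs_sign_le1 t y k W0 e1; set g := gibbs _ _.
rewrite -[g ^+ 2]real_normK ?num_real//; have := normr_ge0 g => g0 g1.
by rewrite ger0_norm; nra.
Qed.

Lemma vgrowth_vnth_gibbs t n W e k : (k < n)%N -> (forall a, 0 < W a) ->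
  (forall k a, e k a ^+ 2 = 1) ->
  vgrowth (fun y : vec n => vnth y k * gibbs (weight t W e y) (e k)).
Proof.
move=> kn W0 e1; split.
  by apply: measurable_funM; [exact: measurable_vnth|exact: measurable_gibbs].
exists 1 => y; rewrite mul1r normrM.
have := gibbs_sign_le1 t y k W0 e1; set g := gibbs _ _ => g1.
apply: (@le_trans _ _ `|vnth y k|); first by rewrite ler_piMr.
have : vnth y k ^+ 2 <= vsq y.
  rewrite /vsq (bigD1 (Ordinal kn))//= lerDl sumr_ge0// => i _.
  exact: sqr_ge0.
rewrite -[vnth y k ^+ 2]real_normK ?num_real//.
by have := sqr_ge0 (`|vnth y k| - 1); nra.
Qed.

(** The coordinate [k] is reached by freezing the first [k] coordinates; it is then
the first one and is integrated before the others by Fubini's theorem. *)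
Lemma gaussian_ibp t n W e k : (k < n)%N -> (forall a, 0 < W a) ->
  (forall k a, e k a ^+ 2 = 1) ->
  (\int[gaussn s n]_y (vnth y k * gibbs (weight t W e y) (e k)) =
   \int[gaussn s n]_y (t * s ^+ 2 * (1 - gibbs (weight t W e y) (e k) ^+ 2)))%R.
Proof.
elim: n k W e => [//|n IHn] k W e kn W0 e1.
have [E1 E2 _ _] := vgrowth_fubini s_gt0 (vgrowth_vnth_gibbs t kn W0 e1).
have [E3 E4 _ _] := vgrowth_fubini s_gt0 (vgrowth_gibbs_sqr t n.+1 k W0 e1).
case: k kn E1 E2 E3 E4 => [|k] kn E1 E2 E3 E4.
  rewrite E2 E4; apply: eq_Rintegral => y _.
  have w0 a : 0 < weight t W (fun k => e k.+1) y a by exact: weight_gt0.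
  have /= := gibbs_sign_ibp t w0 (e1 0%N) => H.
  under eq_Rintegral do rewrite gibbs_weight0.
  under [RHS]eq_Rintegral do rewrite gibbs_weight0.
  exact: H.
rewrite E1 E3; apply: eq_Rintegral => x _.
have := IHn k (freeze t W e x) (fun k => e k.+1) kn (fun a => freeze_gt0 t e x a W0) (fun k => e1 k.+1).
move=> H.
under eq_Rintegral do rewrite gibbsS.
under [RHS]eq_Rintegral do rewrite gibbsS.
exact: H.
Qed.

End gibbs_vec.

(** * The law of independent Gaussian variables *)
Section law.
Context {R : realType} (s : R).
Hypothesis s_gt0 : 0 < s.
Context d (T : measurableType d).

Fixpoint tovec n (x : nat -> R) : vec n :=
  match n return vec n with
  | 0 => tt
  | n.+1 => (x 0%N, tovec n (fun k => x k.+1))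
  end.

Lemma vnth_tovec n x k : (k < n)%N -> vnth (tovec n x) k = x k.
Proof. by elim: n x k => [//|n IHn] x [|k] //= kn; rewrite IHn. Qed.

Lemma measurable_tovec n (X : nat -> T -> R) :
  (forall k, measurable_fun setT (X k)) ->
  measurable_fun setT (fun w => tovec n (X ^~ w)).
Proof.
elim: n X => [|n IHn] X mX; first exact: measurable_cst.
by apply: measurable_fun_pair; [exact: mX|exact: (IHn (fun k => X k.+1))].
Qed.

(** The recursion on [n] restricts the measure to the event that [X 0] lies in [A1];
stating the law for all finite measures, with their mass [c], makes the restricted
measure an instance of the induction hypothesis. *)
Lemma tovec_law n (mu : {finite_measure set T -> \bar R}) (X : nat -> T -> R)
    (c : {nonneg R}) : (forall k, measurable_fun setT (X k)) ->
  (forall B : nat -> set R, (forall k, measurable (B k)) ->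
    mu (\bigcap_(k in [set k | (k < n)%N]) X k @^-1` B k) =
    (c%:num%:E * \prod_(k < n) gauss s (B k))%E) ->
  forall A : set (vec n), measurable A ->
  mu ((fun w => tovec n (X ^~ w)) @^-1` A) = (c%:num%:E * gaussn s n A)%E.
Proof.
elim: n mu X c => [|n IHn] mu X c mX H A mA.
  have := H (fun=> setT) (fun=> measurableT); rewrite big_ord0 mule1 => H0.
  rewrite [gaussn s 0 A]diracE; have [At|At] := boolP (tt \in A).
    rewrite mule1 -H0; congr (mu _); apply/seteqP; split => //= w _.
    exact: set_mem.
  rewrite mule0 -[RHS](measure0 mu); congr (mu _); apply/seteqP; split => //= w.
  by move=> /= /mem_set; rewrite (negbTE At).
have mY := @measurable_tovec n.+1 X mX.
pose m' := pushforward mu (fun w => tovec n.+1 (X ^~ w)).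
have H1 : (mscale c (gauss s) \x gaussn s n)%E A = m' A.
  apply: product_measure_unique => // A1 A2 mA1 mA2.
  have mX0 : measurable (X 0%N @^-1` A1).
    by rewrite -[X in measurable X]setTI; exact: mX.
  have c0 : 0 <= c%:num * fine (gauss s A1) by rewrite mulr_ge0// fine_ge0.
  pose c' := NngNum c0.
  have gA1 : (fine (gauss s A1))%:E = gauss s A1 by rewrite fineK// fin_num_measure.
  rewrite /m' /pushforward.
  transitivity (mu ((fun w => tovec n (fun k => X k.+1 w)) @^-1` A2 `&`
     X 0%N @^-1` A1)).
    by congr (mu _); apply/seteqP; split => w /= [].
  have E := IHn (mrestr mu mX0) (fun k => X k.+1) c' (fun k => mX k.+1) _ _ mA2.
  transitivity (c'%:num%:E * gaussn s n A2)%E; last first.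
    by rewrite /mscale /= EFinM gA1.
  rewrite -E//; move=> B mB.
  pose B' k := if k is k'.+1 then B k' else A1.
  have mB' k : measurable (B' k) by case: k.
  have := H B' mB'; rewrite big_ord_recl /= muleA -gA1 -EFinM => <-.
  rewrite /mrestr; congr (mu _); apply/seteqP; split => w /=.
    by move=> [wB wA] [|k] //= kn; exact: wB.
  move=> wB; split; last exact: (wB 0%N).
  by move=> k kn; exact: (wB k.+1).
have H2 : (mscale c (gauss s) \x gaussn s n)%E A =
    mscale c (gauss s \x gaussn s n)%E A.
  apply: product_measure_unique => // A1 A2 mA1 mA2.
  have E := product_measure1E (gauss s) (gaussn s n) mA1 mA2.
  transitivity (c%:num%:E * (gauss s A1 * gaussn s n A2))%E; last by rewrite muleA.
  by rewrite -E.
by rewrite -[LHS]/(m' A) -H1 H2.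
Qed.

(** Integrals of the disorder are computed on the product space. *)
Lemma tovec_transfer n (P : probability T R) (X : nat -> T -> R) (f : vec n -> R) :
  (forall k, measurable_fun setT (X k)) ->
  (forall A : set (vec n), measurable A ->
    P ((fun w => tovec n (X ^~ w)) @^-1` A) = gaussn s n A) ->
  vgrowth f ->
  P.-integrable setT (EFin \o (fun w => f (tovec n (X ^~ w)))) /\
  (\int[P]_w f (tovec n (X ^~ w)) = \int[gaussn s n]_y f y)%R.
Proof.
move=> mX PX vf; have [mf _] := vf; have mY := @measurable_tovec n X mX.
have intf := vgrowth_integrable s_gt0 vf.
have mEf : measurable_fun setT (EFin \o f) by exact/measurable_EFinP.
pose Y w := tovec n (X ^~ w).
have E (h : vec n -> \bar R) :
    (\int[pushforward P Y]_y h y = \int[gaussn s n]_y h y)%E.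
  by apply: eq_measure_integral => A mA _; exact: PX.
have iY : P.-integrable setT (EFin \o (fun w => f (Y w))).
  apply/integrableP; split; first exact: (measurableT_comp mEf mY).
  have /integrableP[_] := intf; rewrite -E ge0_integral_pushforward//.
  exact: measurableT_comp.
split => //; rewrite /Rintegral -E integral_pushforward//.
Qed.

End law.

(** * The mean free energy as a function of the temperature *)
Section temperature.
Context {R : realType} (s : R).
Hypothesis s_gt0 : 0 < s.
Context {S : finType}.
Hypothesis S0 : inhabited S.
Variables (n : nat) (W : S -> R) (e : nat -> S -> R).
Hypotheses (W0 : forall a, 0 < W a) (e1 : forall k a, e k a ^+ 2 = 1).

Local Notation w t y := (weight t W e (y : vec n)).

Definition mean_lnZ (t : R) := (\int[gaussn s n]_y ln (\sum_a w t y a))%R.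

Definition mean_sqr (k : nat) (t : R) :=
  (\int[gaussn s n]_y (gibbs (w t y) (e k) ^+ 2))%R.

(** The mean of the energy under the Gibbs measure, in the form that
[gaussian_ibp] gives to it. *)
Definition mean_energy (t : R) := \sum_(k < n) t * s ^+ 2 * (1 - mean_sqr k t).

Lemma vgrowth_lnZ t : vgrowth (fun y : vec n => ln (\sum_a w t y a)).
Proof. by apply: vgrowth_sqr; [exact: measurable_lnZ|exact: lnZ_growth]. Qed.

Lemma gibbs_sqr_bound t (y : vec n) k : `|gibbs (w t y) (e k) ^+ 2| <= 1.
Proof.
by rewrite normrX expr_le1// gibbs_sign_le1.
Qed.

Lemma vgrowth_gibbs2 t k : vgrowth (fun y : vec n => gibbs (w t y) (e k) ^+ 2).
Proof.
apply: (@vgrowth_bounded _ _ _ 1); last by move=> y; exact: gibbs_sqr_bound.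
by apply: measurable_funX; exact: measurable_gibbs.
Qed.

Lemma mean_energyE t : mean_energy t =
  \sum_(k < n) (\int[gaussn s n]_y (vnth y k * gibbs (w t y) (e k)))%R.
Proof.
apply: eq_bigr => k _; rewrite gaussian_ibp//.
have i2 := vgrowth_integrable s_gt0 (vgrowth_gibbs2 t k).
have i1 := finite_measure_integrable_cst (gaussn s n) (1 : R) measurableT.
rewrite RintegralZl//; last exact: (integrableB measurableT i1 i2).
by rewrite RintegralB// Rintegral_prob_cst.
Qed.

(** The free energy is convex in [t], with the Gibbs average of the energy as
derivative. *)
Lemma mean_lnZ_subgradient t t' : mean_lnZ t + mean_energy t * (t' - t) <= mean_lnZ t'.
Proof.
pose f (k : 'I_n) (y : vec n) := vnth y k * gibbs (w t y) (e k).
have vf k : vgrowth (f k) by exact: vgrowth_vnth_gibbs.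
have iF k := vgrowth_integrable s_gt0 (vf k).
have [isum Esum] := Rintegral_sum (index_enum _) iF.
have iL u := vgrowth_integrable s_gt0 (vgrowth_lnZ u).
have isumZ := integrableZr measurableT (t' - t) isum.
rewrite mean_energyE -Esum -RintegralZr// -RintegralD//.
apply: le_Rintegral => //; first exact: (integrableD measurableT (iL t) isumZ).
move=> y _; have w0 a : 0 < w t y a by exact: weight_gt0.
have := ln_gibbs_jensen S0 w0 (fun a => (t' - t) * energy e y a).
rewrite gibbsZ (_ : \sum_a _ * expR _ = \sum_a w t' y a); last first.
  by apply: eq_bigr => a _; rewrite /weight -mulrA -expRD -mulrDl subrKC.
rewrite mulrC (_ : gibbs _ _ = \sum_(k < n) f k y)//.
rewrite /energy gibbs_sum; apply: eq_bigr => k _.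
by rewrite gibbsZ.
Qed.

Lemma continuous_gibbs (y : vec n) k : continuous (fun t => gibbs (w t y) (e k)).
Proof.
have cw a : continuous (fun t => w t y a).
  move=> t; apply: cvgMr.
  apply: (@cvg_comp _ _ _ (fun t => t * energy e y a) expR); last exact: continuous_expR.
  by apply: cvgMl; exact: cvg_id.
move=> t; apply: cvgM.
  by apply: (@continuous_bigsum R S _ (fun a t => e k a * w t y a)) => a u; apply: cvgMr; exact: cw.
apply: cvgV; last exact: (@continuous_bigsum R S _ (fun a t => w t y a)).
by rewrite gt_eqF//; apply: sum_gt0 => // a; exact: weight_gt0.
Qed.

Lemma continuous_mean_sqr k : continuous (mean_sqr k).
Proof.
move=> t.
have H : {in `]t - 1, t + 1[%classic, continuous (mean_sqr k)}.
  apply: (@continuity_under_integral _ _ _ (gaussn s n)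
    (fun t y => gibbs (w t y) (e k) ^+ 2) setT measurableT (t - 1) (t + 1) _ _ (fun=> 1)).
  - by move=> u _; exact: (vgrowth_integrable s_gt0 (vgrowth_gibbs2 u k)).
  - apply: aeW => y _ u _; apply: cvgM; exact: continuous_gibbs.
  - exact: finite_measure_integrable_cst.
  - by move=> u _; apply: aeW => y _; exact: gibbs_sqr_bound.
apply: H; rewrite inE/= in_itv/=; lra.
Qed.

Lemma continuous_mean_energy : continuous mean_energy.
Proof.
apply: continuous_bigsum => k t; apply: cvgM; first by apply: cvgMl; exact: cvg_id.
by apply: cvgB (cvg_cst _) _; exact: continuous_mean_sqr.
Qed.

Lemma integral_mean_energy b : 0 <= b ->
  (\int[lebesgue_measure]_(t in `[0, b]) mean_energy t = mean_lnZ b - mean_lnZ 0)%R.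
Proof.
move=> b0; apply: is_derive_FTC => //; last exact: continuous_mean_energy.
exact: is_derive_subgradient mean_lnZ_subgradient continuous_mean_energy.
Qed.

Lemma mean_lnZ0 : mean_lnZ 0 = ln (\sum_a W a).
Proof.
rewrite /mean_lnZ (_ : (fun y => _) = fun=> ln (\sum_a W a)) ?Rintegral_prob_cst//.
apply/funext => y; congr ln; apply: eq_bigr => a _.
by rewrite /weight mul0r expR0 mulr1.
Qed.

End temperature.

(** * The Sherrington-Kirkpatrick model as a Gibbs average *)
Section sherrington_kirkpatrick.
Context {R : realType} (N : nat) (i0 : 'I_N).

Definition lt_pairs : {set 'I_N * 'I_N} :=
  finset (fun p : 'I_N * 'I_N => (p.1 < p.2)%N).

Definition npairs := size (enum lt_pairs).

Definition pair_at k : 'I_N * 'I_N := nth (i0, i0) (enum lt_pairs) k.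

Definition edge_sign k (a : config N) : R := spin R a (pair_at k).1 * spin R a (pair_at k).2.

Definition couplings (x : 'I_N -> 'I_N -> R) k := x (pair_at k).1 (pair_at k).2.

Lemma spin_sqr (a : config N) i : spin R a i ^+ 2 = 1.
Proof. by rewrite /spin -exprM mulnC exprM sqrrN !expr1n. Qed.

Lemma edge_sign_sqr k a : edge_sign k a ^+ 2 = 1.
Proof. by rewrite exprMn !spin_sqr mulr1. Qed.

Lemma sum_lt_pairs (f : 'I_N -> 'I_N -> R) :
  \sum_(i < N) \sum_(j < N | (i < j)%N) f i j =
  \sum_(k < npairs) f (pair_at k).1 (pair_at k).2.
Proof.
rewrite pair_big_dep /= -(big_mkord xpredT (fun k => f (pair_at k).1 (pair_at k).2)).
rewrite -(big_nth (i0, i0) xpredT (fun p => f p.1 p.2)) big_enum /=.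
by apply: eq_bigl => p; rewrite inE.
Qed.

(** Applied below to the square of a Gibbs average and to the constant [1], which
counts the pairs. *)
Lemma sum_symmetric (f : 'I_N -> 'I_N -> R) : (forall i j, f i j = f j i) ->
  \sum_(i < N) \sum_(j < N) f i j =
  \sum_(i < N) f i i + 2 * \sum_(k < npairs) f (pair_at k).1 (pair_at k).2.
Proof.
move=> fC; rewrite -sum_lt_pairs.
have H i : \sum_(j < N) f i j =
   f i i + (\sum_(j < N | (i < j)%N) f i j + \sum_(j < N | (j < i)%N) f i j).
  rewrite (bigD1 i)//=; congr (_ + _).
  rewrite (bigID (fun j : 'I_N => (i < j)%N))/=; congr (_ + _); apply: eq_bigl => j.
    by rewrite neq_ltn orbC; case: (ltngtP i j) => //=; rewrite andbF.
  by rewrite -leqNgt leq_eqVlt -val_eqE; case: (ltngtP j i).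
under eq_bigr do rewrite H.
rewrite 2!big_split /= mulr_natl mulr2n; congr (_ + (_ + _)).
rewrite (exchange_big_dep xpredT)//=; apply: eq_bigr => j _.
by apply: eq_bigr => i _; rewrite fC.
Qed.

Lemma hamiltonianE x a :
  hamiltonian x a = energy edge_sign (tovec npairs (couplings x)) a.
Proof.
rewrite /hamiltonian (sum_lt_pairs (fun i j => x i j * spin R a i * spin R a j)).
by apply: eq_bigr => k _; rewrite vnth_tovec// -mulrA.
Qed.

Definition unif (a : config N) : R := (2 ^+ N)^-1.

Lemma unif_gt0 a : 0 < unif a.
Proof. by rewrite invr_gt0 exprn_gt0. Qed.

Lemma sum_unif : \sum_a unif a = 1.
Proof.
have cN : #|config N| = (2 ^ N)%N by rewrite card_ffun card_bool card_ord.
by rewrite sumr_const cN -[LHS]mulr_natl natrX divff// expf_neq0.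
Qed.

Lemma partition_functionE t x : partition_function t x =
  \sum_a weight t unif edge_sign (tovec npairs (couplings x)) a.
Proof.
rewrite /partition_function mulr_sumr; apply: eq_bigr => a _.
by rewrite /weight hamiltonianE.
Qed.

Lemma free_energyE t x : free_energy t x =
  ln (\sum_a weight t unif edge_sign (tovec npairs (couplings x)) a).
Proof. by rewrite /free_energy partition_functionE. Qed.

(** The square of the overlap is an average over pairs [i, j] of a product
of a function of each replica, so its replica average is an average of squares. *)
Lemma gibbs_overlap_sqr t x :
  gibbs_average t x (fun a b => (overlap R a b ^+ 2)%R) =
  N%:R^-1 ^+ 2 * (N%:R + 2 * \sum_(k < npairs)
    gibbs (weight t unif edge_sign (tovec npairs (couplings x))) (edge_sign k) ^+ 2).
Proof.
set w := weight _ _ _ _.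
have wE a : w a = (2 ^+ N)^-1 * expR (t * hamiltonian x a) by rewrite hamiltonianE.
have C0 : inhabited (config N) by exact: (inhabits [ffun=> false]).
have w0 a : 0 < w a by apply: weight_gt0 => ?; exact: unif_gt0.
have Z0 : \sum_a w a != 0 by rewrite gt_eqF// sum_gt0.
pose g i j := gibbs w (fun a => spin R a i * spin R a j).
have -> : N%:R + 2 * \sum_(k < npairs) gibbs w (edge_sign k) ^+ 2 =
    \sum_(i < N) \sum_(j < N) g i j ^+ 2.
  rewrite (sum_symmetric (f := fun i j => g i j ^+ 2)); last first.
    by move=> i j; rewrite /g; congr (gibbs _ _ ^+ 2); apply/funext => a; rewrite mulrC.
  congr (_ + _); rewrite (eq_bigr (fun=> 1)) ?sumr_const ?card_ord// => i _.
  rewrite /g (_ : (fun a => _) = fun=> 1) ?gibbs_cst ?expr1n//.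
  by apply/funext => a; rewrite -expr2 spin_sqr.
rewrite /gibbs_average.
have -> : 4 ^+ N * partition_function t x ^+ 2 = (2 ^+ N * \sum_a w a) ^+ 2.
  rewrite partition_functionE -/w (_ : 4 = 2 ^+ 2); last by rewrite -natrX.
  by rewrite -exprM mulnC exprM -exprMn.
have E a b : overlap R a b ^+ 2 *
      expR (t * hamiltonian x a + t * hamiltonian x b) =
    N%:R^-1 ^+ 2 * (2 ^+ N) ^+ 2 * \sum_(i < N) \sum_(j < N)
      (spin R a i * spin R a j * w a) * (spin R b i * spin R b j * w b).
  rewrite expRD; have two : (2 ^+ N : R) != 0 by rewrite expf_neq0.
  have Eu u : expR (t * hamiltonian x u) = 2 ^+ N * w u by rewrite wE mulVKf.
  rewrite !Eu /overlap; pose m := \sum_(i < N) spin R a i * spin R b i.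
  rewrite -/m; have -> : \sum_(i < N) \sum_(j < N)
      (spin R a i * spin R a j * w a) * (spin R b i * spin R b j * w b) =
      m * m * (w a * w b).
    rewrite /m big_distrlr/= mulr_suml; apply: eq_bigr => i _.
    by rewrite mulr_suml; apply: eq_bigr => j _; ring.
  by ring.
rewrite [X in _ * X = _](eq_bigr (fun a => N%:R^-1 ^+ 2 * (2 ^+ N) ^+ 2 *
    \sum_(b : config N) \sum_(i < N) \sum_(j < N)
      (spin R a i * spin R a j * w a) * (spin R b i * spin R b j * w b))); last first.
  by move=> a _; rewrite [RHS]mulr_sumr; apply: eq_bigr => b _; exact: E.
rewrite -[X in _ * X = _]mulr_sumr.
have -> : \sum_(a : config N) \sum_(b : config N) \sum_(i < N) \sum_(j < N)
    (spin R a i * spin R a j * w a) * (spin R b i * spin R b j * w b) =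
    (\sum_a w a) ^+ 2 * \sum_(i < N) \sum_(j < N) g i j ^+ 2.
  under eq_bigr do rewrite exchange_big/=.
  rewrite exchange_big/= mulr_sumr; apply: eq_bigr => i _.
  under eq_bigr do rewrite exchange_big/=.
  rewrite exchange_big/= mulr_sumr; apply: eq_bigr => j _.
  rewrite -exprMn /g /gibbs mulrC divfK// expr2 big_distrlr/=.
  by apply: eq_bigr.
have N0 : N%:R != 0 :> R by rewrite pnatr_eq0 -lt0n (leq_ltn_trans _ (ltn_ord i0)).
have two0 : (2 ^+ N : R) != 0 by rewrite expf_neq0.
by field; rewrite Z0 N0 two0.
Qed.

End sherrington_kirkpatrick.

(** * The law of the disorder and the variance bound *)
Section disorder.
Context (R : realType) (d : measure_display) (T : measurableType d)
  (P : probability T R) (N : nat) (g : 'I_N -> 'I_N -> {RV P >-> R}) (i0 : 'I_N).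
Hypothesis gD : gaussian_disorder g.

Local Notation s := (Num.sqrt (N%:R^-1 : R)).
Local Notation X k := (fun w => couplings i0 (fun i j => g i j w) k).

Lemma sqrt_invN_gt0 : 0 < s.
Proof. by rewrite sqrtr_gt0 invr_gt0 ltr0n (leq_ltn_trans _ (ltn_ord i0)). Qed.

Lemma sqr_sqrt_invN : s ^+ 2 = N%:R^-1.
Proof. by rewrite sqr_sqrtr// invr_ge0. Qed.

Lemma measurable_couplings k : measurable_fun setT (X k).
Proof. exact: measurable_funPT. Qed.

(** Independence is used for the full set of pairs only, with the event of each pair
indexed by its rank in the enumeration. *)
Lemma disorder_law (A : set (vec (npairs N))) : measurable A ->
  P ((fun w => tovec (npairs N) (fun k => X k w)) @^-1` A) = gaussn s (npairs N) A.
Proof.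
move=> mA; have [glaw gind] := gD.
have := @tovec_law R s _ T (npairs N) P (fun k => X k) 1%:nng
  measurable_couplings _ A mA.
rewrite /= mul1e; apply => B mB; rewrite mul1e.
have u := enum_uniq (mem (lt_pairs N)).
have atk k : (k < npairs N)%N -> pair_at i0 k \in lt_pairs N.
  by move=> kn; rewrite -mem_enum mem_nth.
have idx k : (k < npairs N)%N -> index (pair_at i0 k) (enum (lt_pairs N)) = k.
  by move=> kn; rewrite index_uniq.
have := gind (lt_pairs N) (fun p => B (index p (enum (lt_pairs N)))) (subxx _) (fun p => mB _).
rewrite (_ : \bigcap_(i in _) _ = \bigcap_(k in [set k | (k < npairs N)%N]) X k @^-1` B k); last first.
  apply/seteqP; split => w /= H.
    by move=> k kn; have := H _ (atk k kn); rewrite /= idx.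
  move=> p pin; have pin' : p \in enum (lt_pairs N) by rewrite mem_enum.
  have kn : (index p (enum (lt_pairs N)) < npairs N)%N by rewrite /npairs index_mem.
  by have := H _ kn; rewrite /= /couplings /pair_at nth_index.
move=> ->; rewrite (eq_bigr (fun p => gauss s (B (index p (enum (lt_pairs N)))))); last first.
  move=> p; rewrite inE => plt; exact: (glaw _ _ plt _ (mB _)).
rewrite -big_enum /= (big_nth (i0, i0)) big_mkord; apply: eq_bigr => k _.
by rewrite -/(pair_at i0 k) idx.
Qed.

End disorder.

Lemma variance_Rintegral (R : realType) d (T : measurableType d) (P : probability T R)
    (F : T -> R) :
  P.-integrable setT (EFin \o F) -> P.-integrable setT (EFin \o (fun w => F w ^+ 2)) ->
  'V_P[F] = ((\int[P]_w (F w ^+ 2)) - (\int[P]_w F w) ^+ 2)%R%:E.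
Proof.
move=> iF iF2; rewrite /variance covariance.unlock expectation.unlock.
set c := fine _; have cE : c = (\int[P]_w F w)%R by [].
have i1 := finite_measure_integrable_cst P (c ^+ 2) measurableT.
have i2 := integrableZl measurableT (2 * c) iF.
have i3 := integrableB measurableT iF2 i2.
rewrite (_ : (fun x => _) = EFin \o (fun w => F w ^+ 2 - 2 * c * F w + c ^+ 2)); last first.
  by apply/funext => w /=; congr EFin; rewrite -[LHS]/((F w - c) * (F w - c)); ring.
rewrite -[LHS]fineK; last exact: integrable_fin_num (integrableD measurableT i3 i1).
congr EFin; rewrite -[LHS]/(\int[P]_w (F w ^+ 2 - 2 * c * F w + c ^+ 2))%R.
rewrite RintegralD// RintegralB// RintegralZl// Rintegral_prob_cst -cE.
by ring.
Qed.

Unset Implicit Arguments.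
Set Strict Implicit.

Theorem proposition3 (R : realType) (d : measure_display)
    (T : measurableType d) (P : probability T R) (N : nat)
    (g : 'I_N -> 'I_N -> {RV P >-> R}) (beta : R) :
  (1 <= N)%N ->
  gaussian_disorder g ->
  0 <= beta <= 1 ->
  ('V_P[fun w => free_energy beta (fun i j => g i j w)] <=
     N%:R%:E *
     (\int[lebesgue_measure]_(s in `[0%R, beta]%classic)
        (s%:E * 'E_P[fun w => gibbs_average s (fun i j => g i j w)
                               (fun sigma rho => (overlap R sigma rho ^+ 2)%R)]))
     - (beta ^+ 2 / 2)%R%:E)%E.
Proof.
move=> N1 gD /andP[b0 _].
pose i0 : 'I_N := Ordinal N1.
pose s : R := Num.sqrt (N%:R^-1).
have s_gt0 : 0 < s by exact: sqrt_invN_gt0 i0.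
have s2 : s ^+ 2 = N%:R^-1 by exact: sqr_sqrt_invN.
pose n := npairs N; pose e := edge_sign (R := R) i0.
have C0 : inhabited (config N) by exact: (inhabits [ffun=> false]).
have W0 := @unif_gt0 R N; have e1 := edge_sign_sqr (R := R) i0.
pose Y w := tovec n (fun k => couplings i0 (fun i j => g i j w) k).
have transfer f := tovec_transfer s_gt0 (measurable_couplings g i0) (disorder_law i0 gD) (f := f).
have N0 : N%:R != 0 :> R by rewrite pnatr_eq0 -lt0n.
have nE : N%:R + 2 * n%:R = N%:R * N%:R :> R.
  have := sum_symmetric i0 (fun i j => erefl (1 : R)).
  by rewrite !sumr_const !card_ord -mulrnA natrM => ->.
pose psi := mean_lnZ s n (unif (R := R) (N := N)) e.
have vL t := vgrowth_lnZ C0 n W0 e1 t.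
have vL2 t := lnZ_growth C0 t n W0 e1.
have -> : (fun w => free_energy beta (fun i j => g i j w)) =
    (fun w => ln (\sum_a weight beta (unif (R := R) (N := N)) e (Y w) a)).
  by apply/funext => w; rewrite (free_energyE i0).
have [iF EF] := transfer _ (vL beta); have [iF2 EF2] := transfer _ (vL2 beta).
rewrite variance_Rintegral// EF EF2.
have := variance_lnZ_le s_gt0 C0 beta n W0 e1.
rewrite sum_unif ln1 addr0 -/(mean_lnZ s n (unif (R := R) (N := N)) e beta) -/(psi beta).
set M2 := (\int[_]_y _ ^+ 2)%R => V_le.
pose h t := t - 2 / N%:R * mean_energy s n (unif (R := R) (N := N)) e t.
have hE t : (t%:E * 'E_P[fun w => gibbs_average t (fun i j => g i j w)
    (fun sigma rho => (overlap R sigma rho ^+ 2)%R)] = (h t)%:E)%E.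
  have vg k := vgrowth_gibbs2 C0 n W0 e1 t k.
  pose r (k : 'I_n) := fun w => gibbs (weight t (unif (R := R) (N := N)) e (Y w)) (e k) ^+ 2.
  have ir k := (transfer _ (vg k)).1.
  have [isum Esum] := Rintegral_sum (f := r) (index_enum _) (fun k : 'I_n => ir k).
  have i2 := integrableZl measurableT 2 isum.
  have i1 := finite_measure_integrable_cst P (N%:R : R) measurableT.
  have i3 := integrableD measurableT i1 i2.
  rewrite expectation.unlock (_ : (fun w => _) = EFin \o (fun w => N%:R^-1 ^+ 2 *
      (N%:R + 2 * \sum_(k < n) r k w))); last first.
    by apply/funext => w /=; rewrite (gibbs_overlap_sqr i0).
  rewrite -[X in (_ * X)%E]fineK; last first.
    exact: integrable_fin_num (integrableZl measurableT (N%:R^-1 ^+ 2) i3).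
  rewrite -EFinM; congr EFin.
  rewrite -[fine _]/(\int[P]_w (N%:R^-1 ^+ 2 * (N%:R + 2 * \sum_(k < n) r k w)))%R.
  rewrite RintegralZl// RintegralD// RintegralZl// Rintegral_prob_cst Esum.
  rewrite (eq_bigr (fun k : 'I_n => mean_sqr s n (unif (R := R) (N := N)) e k t)); last first.
    by move=> k _; exact: (transfer _ (vg k)).2.
  (* N E<R^2> is 1 plus 2 / N times the sum of the squared correlations over the
     n = N (N - 1) / 2 pairs. *)
  rewrite /h /mean_energy -mulr_sumr s2 big_split /= sumr_const card_ord sumrN.
  set q := \sum_(k < n) _; rewrite (_ : 1 *+ n = (N%:R * N%:R - N%:R) / 2); last first.
    by rewrite -nE; field.
  by field.
under eq_integral do rewrite hE.
have cE := continuous_mean_energy s_gt0 C0 W0 e1 (n := n).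
have ch : continuous h.
  by move=> t; apply: cvgB; [exact: cvg_id|apply: cvgMr; exact: cE].
have icont (f : R -> R) : continuous f ->
    (@lebesgue_measure R).-integrable `[0, beta] (EFin \o f).
  move=> cf; apply: continuous_compact_integrable; first exact: segment_compact.
  exact: continuous_subspaceT.
have -> : (\int[lebesgue_measure]_(t in `[0%R, beta]) (h t)%:E =
    (beta ^+ 2 / 2 - 2 / N%:R * psi beta)%:E)%E.
  rewrite -[LHS]fineK; last by apply: integrable_fin_num => //; exact: icont.
  congr EFin; rewrite -[LHS]/(\int[lebesgue_measure]_(t in `[0%R, beta]) h t)%R.
  have cid : continuous (fun t : R => t) by move=> t; exact: cvg_id.
  have iE := icont _ cE.
  have mI : measurable (`[0, beta]%classic : set (measurableTypeR R)) by exact: measurable_itv.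
  have iEZ := integrableZl mI (2 / N%:R) iE.
  rewrite RintegralB//; last exact: icont.
  rewrite RintegralZl// integral_mean_energy// mean_lnZ0 sum_unif ln1 subr0.
  congr (_ - _).
  have dsq (t : R) : is_derive t 1 (fun t : R => t * t * 2^-1) t.
    apply: is_derive_eq (is_derive_mul (is_derive_mul (is_derive_id t 1)
      (is_derive_id t 1)) (is_derive_cst (2^-1 : R) t 1)) _.
    by rewrite /=; field.
  by rewrite (is_derive_FTC dsq cid b0); field.
rewrite -EFinM -EFinB lee_fin.
have := V_le; rewrite s2.
have -> : n%:R * (beta ^+ 2 / N%:R / 2) = (N%:R - 1) * beta ^+ 2 / 4 :> R.
  have -> : n%:R = (N%:R * N%:R - N%:R) / 2 :> R by rewrite -nE; field.
  by field.
have -> : N%:R * (beta ^+ 2 / 2 - 2 / N%:R * psi beta) = N%:R * beta ^+ 2 / 2 - 2 * psi beta.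
  by field.
lra.
Qed.
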